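(* Let $n\ge1$ and let $T$ be the tip $T_{(1,1)}$ of the Magic Star of $\mathbf e_8^{(n)}$ over $\mathfrak F$, with the product $x\circ y=\frac12[[x,I^-],y]$, the element $I$ and the form $tr$ defined in the context. Then: 1. the product $(x,y)\mapsto x\circ y$ on $T$ is commutative; 2. $I\in T$ is the identity for this product; 3. $x_{P1},x_{P2},x_{P3}\in T$ are trace-one idempotents, hence are rank-1 elements of $T$; 4. every $x_\alpha\in T$ ($\alpha\in T_{(1,1)}$) other than $x_{P1},x_{P2},x_{P3}$ is nilpotent and traceless, hence is also a rank-1 element of $T$; 5. $x\mapsto tr(x)$ is a trace form, namely $tr(x,y):=tr(x\circ y)$ is bilinear and symmetric in $x,y$, and $tr(x\circ y,z)=tr(x,y\circ z)$ for all $x,y,z\in T$.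
   Context: Notation. Let $\mathfrak F$ be a field of characteristic $0$, $n\ge1$ an integer, $N=4(n+1)$, and $k_1,\dots,k_N$ an orthonormal basis of a Euclidean space with scalar product $(\cdot,\cdot)$. The generalized roots of $\mathbf e_8^{(n)}$ are $\Phi=\Phi_O\cup\Phi_S$, $\Phi_O=\{\pm k_i\pm k_j:1\le i<j\le N\}$, $\Phi_S=\{\frac12(\pm k_1\pm\dots\pm k_N)$ with an even number of $+$ signs$\}$. The ordered simple generalized roots are $\alpha_i=k_i-k_{i+1}$ ($1\le i\le N-2$), $\alpha_{N-1}=k_{N-2}+k_{N-1}$, $\alpha_N=-\frac12(k_1+\dots+k_N)$. Every element of $\Phi$ is an integer combination of them. Let $\mathbb L=\bigoplus_i\mathbb Z\alpha_i$. The asymmetry function $\varepsilon:\mathbb L\times\mathbb L\to\{-1,1\}$ is $\varepsilon(\sum_i\ell_i\alpha_i,\sum_jm_j\alpha_j)=\prod_{i,j}\varepsilon(\alpha_i,\alpha_j)^{\ell_im_j}$, where $\varepsilon(\alpha_i,\alpha_j)=-1$ if $i=j$, $=-1$ if $\alpha_i+\alpha_j\in\Phi$ and $i<j$, and $=+1$ otherwise. The algebra $\mathbf e_8^{(n)}$ is the (in general non-Lie) algebra over $\mathfrak F$ with basis $\{h_1,\dots,h_N\}\cup\{x_\alpha:\alpha\in\Phi\}$ and bilinear product $[h_i,h_j]=0$; $[h_i,x_\alpha]=-[x_\alpha,h_i]=(\alpha,\alpha_i)x_\alpha$; $[x_\alpha,x_{-\alpha}]=-h_\alpha$; $[x_\alpha,x_\beta]=0$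 if $\alpha+\beta\notin\Phi$ and $\alpha\ne-\beta$; $[x_\alpha,x_\beta]=\varepsilon(\alpha,\beta)x_{\alpha+\beta}$ if $\alpha+\beta\in\Phi$. Here $h_\alpha:=\sum_ic_ih_i$ for $\alpha=\sum_ic_i\alpha_i$. The tip. $T_{(1,1)}\subset\Phi$ is the set of roots $-k_2-k_3$; $k_1\pm k_i$ ($4\le i\le N$); $\frac12(k_1-k_2-k_3\pm k_4\pm\dots\pm k_N)$ with an even number of $+$ signs. $T$ is the $\mathfrak F$-span of $\{x_\alpha:\alpha\in T_{(1,1)}\}$. Put $\rho_1=k_1+k_N$, $\rho_2=k_1-k_N$, $\rho_3=-k_2-k_3$, $x_{Pi}=x_{\rho_i}$, $\bar x_{Pi}=x_{-\rho_i}$, $I=x_{P1}+x_{P2}+x_{P3}$, $I^-=-\bar x_{P1}-\bar x_{P2}-\bar x_{P3}$. For $x,y\in T$ set $x\circ y=\frac12[[x,I^-],y]$, which lies in $T$, and $x^2=x\circ x$. For $x=\ell_1x_{P1}+\ell_2x_{P2}+\ell_3x_{P3}+\sum_{\alpha\in T_{(1,1)},\,\alpha\neq\rho_1,\rho_2,\rho_3}\ell_\alpha x_\alpha$ set $tr(x)=\ell_1+\ell_2+\ell_3$, and $tr(x,y)=tr(x\circ y)$. Define $x^\#=x^2-tr(x)\,x-\frac12\big(tr(x^2)-tr(x)^2\big)I$; $x$ is called rank-1 if $x^\#=0$. Idempotent means $x^2=x$; nilpotent refers to the product $\circ$. *)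

(* Defs.v *)
From mathcomp Require Import all_boot all_order all_algebra.

Set Implicit Arguments.
Unset Strict Implicit.
Unset Printing Implicit Defensive.

Import Order.TTheory GRing.Theory Num.Theory.
Local Open Scope ring_scope.

(* The rank N = 4(n+1). *)
Definition rk (n : nat) : nat := (4 * n.+1)%N.

(* The roots have half-integer coordinates in the orthonormal basis, so the
   Euclidean space is represented by its rational points. *)
Notation evec n := 'rV[rat]_(rk n).

Definition dot (n : nat) (u v : evec n) : rat := \sum_i u 0 i * v 0 i.

(* The orthonormal basis is numbered from 1: k n 1, ..., k n (rk n). *)
Definition k (n j : nat) : evec n := \row_(i < rk n) (i.+1 == j)%:R.

(* Half the sum of the +/- k_i, with sign + exactly when the 0-based position
   of k_i is in A. *)
Definition spinor (n : nat) (A : {set 'I_(rk n)}) : evec n :=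
  2^-1 *: \sum_(i < rk n) (if i \in A then k n i.+1 else - k n i.+1).

Definition PhiO (n : nat) : seq (evec n) :=
  flatten [seq [:: k n i + k n j; k n i - k n j; - k n i + k n j; - k n i - k n j]
          | i <- index_iota 1 (rk n).+1, j <- index_iota i.+1 (rk n).+1].

Definition PhiS (n : nat) : seq (evec n) :=
  [seq spinor A | A in [pred A : {set 'I_(rk n)} | ~~ odd #|A|]].

Definition Phi (n : nat) : seq (evec n) := PhiO n ++ PhiS n.

(* The roots as a finite type; repetitions in the list [Phi n] do not
   matter. *)
Notation Phi_type n := (seq_sub (Phi n)).

(* alpha_j for 1 <= j <= N. *)
Definition alpha (n j : nat) : evec n :=
  if j == rk n then - (2^-1 *: \sum_(1 <= i < (rk n).+1) k n i)
  else if j == (rk n).-1 then k n (rk n).-2 + k n (rk n).-1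
  else k n j - k n j.+1.

(* Here, and wherever an index lies in 'I_(rk n), the simple roots are
   numbered from 0. *)
Definition simples (n : nat) : (rk n).-tuple (evec n) :=
  [tuple alpha n i.+1 | i < rk n].

Definition scoef (n : nat) (u : evec n) (i : 'I_(rk n)) : rat :=
  coord (simples n) i u.

Definition eps0 (n : nat) (i j : 'I_(rk n)) : int :=
  if i == j then -1
  else if (alpha n i.+1 + alpha n j.+1 \in Phi n) && (i < j)%N then -1
  else 1.

(* On the root lattice the coefficients [scoef] are integers, hence equal to
   their numerators. *)
Definition eps (n : nat) (u v : evec n) : int :=
  \prod_(i < rk n) \prod_(j < rk n)
    eps0 i j ^ (numq (scoef u i) * numq (scoef v j)).

(* Elements are given by their coordinates in the basis h_i (inl i),
   x_alpha (inr alpha). *)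
Notation basis_index n := ('I_(rk n) + Phi_type n)%type.
Notation e8 F n := {ffun basis_index n -> F^o}.

Definition h (F : fieldType) (n : nat) (i : 'I_(rk n)) : e8 F n :=
  [ffun b => if b is inl j then (j == i)%:R else 0].

(* Junk value 0 when u is not a root. *)
Definition x_ (F : fieldType) (n : nat) (u : evec n) : e8 F n :=
  [ffun b => if b is inr r then (val r == u)%:R else 0].

Definition h_ (F : fieldType) (n : nat) (u : evec n) : e8 F n :=
  \sum_(i < rk n) (ratr (scoef u i) : F) *: h F i.

Definition bracket_basis (F : fieldType) (n : nat) (a b : basis_index n) :
    e8 F n :=
  match a, b with
  | inl _, inl _ => 0
  | inl i, inr r => (ratr (dot (val r) (alpha n i.+1)) : F) *: x_ F (val r)
  | inr r, inl i => - ((ratr (dot (val r) (alpha n i.+1)) : F) *: x_ F (val r))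
  | inr r, inr s =>
      if val s == - val r then - h_ F (val r)
      else if val r + val s \in Phi n
      then ((eps (val r) (val s))%:~R : F) *: x_ F (val r + val s)
      else 0
  end.

Definition bracket (F : fieldType) (n : nat) (x y : e8 F n) : e8 F n :=
  \sum_a \sum_b ((x a : F) * (y b : F)) *: bracket_basis F a b.

(* In the spinorial roots the number of + signs is counted with that of k_1,
   as in [PhiS]. *)
Definition tip_Phi (n : nat) : seq (evec n) :=
  (- k n 2 - k n 3)
  :: [seq k n 1 + k n i | i <- index_iota 4 (rk n).+1]
  ++ [seq k n 1 - k n i | i <- index_iota 4 (rk n).+1]
  ++ [seq spinor A | A in [pred A : {set 'I_(rk n)} | ~~ odd #|A| &
       [forall i : 'I_(rk n), (i < 3)%N ==> ((i \in A) == (i == 0%N :> nat))]]].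

Definition tip (F : fieldType) (n : nat) : {vspace e8 F n} :=
  <<[seq x_ F u | u <- tip_Phi n]>>%VS.

Definition rho1 (n : nat) : evec n := k n 1 + k n (rk n).
Definition rho2 (n : nat) : evec n := k n 1 - k n (rk n).
Definition rho3 (n : nat) : evec n := - k n 2 - k n 3.
Definition rhos (n : nat) : seq (evec n) := [:: rho1 n; rho2 n; rho3 n].

Definition Iplus (F : fieldType) (n : nat) : e8 F n :=
  x_ F (rho1 n) + x_ F (rho2 n) + x_ F (rho3 n).

Definition Iminus (F : fieldType) (n : nat) : e8 F n :=
  - x_ F (- rho1 n) - x_ F (- rho2 n) - x_ F (- rho3 n).

Definition circ (F : fieldType) (n : nat) (x y : e8 F n) : e8 F n :=
  (2^-1 : F) *: bracket (bracket x (Iminus F n)) y.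

(* The coordinate of x along x_u; 0 when u is not a root. *)
Definition xcoef (F : fieldType) (n : nat) (u : evec n) (x : e8 F n) : F :=
  if (insub u : option (Phi_type n)) is Some r then x (inr r) else 0.

Definition tr (F : fieldType) (n : nat) (x : e8 F n) : F :=
  xcoef (rho1 n) x + xcoef (rho2 n) x + xcoef (rho3 n) x.

Definition trform (F : fieldType) (n : nat) (x y : e8 F n) : F := tr (circ x y).

Definition sharp (F : fieldType) (n : nat) (x : e8 F n) : e8 F n :=
  circ x x - tr x *: x - (2^-1 * (tr (circ x x) - tr x ^+ 2)) *: Iplus F n.

Definition rank1 (F : fieldType) (n : nat) (x : e8 F n) : Prop := sharp x = 0.

Definition idempotent_circ (F : fieldType) (n : nat) (x : e8 F n) : Prop :=
  circ x x = x.

(* The product is not associative: powers are principal powers,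
   x^(m+1) = x o x^m, and [circ_pow x m] is the (m+1)-st power. *)
Definition circ_pow (F : fieldType) (n : nat) (x : e8 F n) (m : nat) : e8 F n :=
  iter m (circ x) x.

Definition nilpotent_circ (F : fieldType) (n : nat) (x : e8 F n) : Prop :=
  exists m : nat, circ_pow x m = 0.

(* Main.v *)
(* The tip consists of the roots u with u_2 = u_3 = u_1 - 1, so u + v - rho_i
   is in the tip as soon as it is a root. The weights (rho_i, u) of a tip root
   lie in {0, 1, 2} and add up to 2, with weight 2 only at u = rho_i (a Peirce
   decomposition). Hence x_(rho_i) o x_u = (rho_i, u)/2 x_u, and for u, v
   different from the rho_i the product x_u o x_v is half the sum of
   the s_i(u, v) x_(u + v - rho_i), where
   s_i(u, v) = - eps(u, rho_i) eps(u, v) eps(rho_i, v).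
   Everything about these signs follows from the bimultiplicativity of eps and
   from eps(u, u) = -1 on the tip: s_i is symmetric when u + v - rho_i is a root,
   and s_i(u, v) = s_j(u, v) when u + v = rho_i + rho_j. If none of u, v, w is
   a rho_i, then tr((x_u o x_v) o x_w) vanishes unless
   u + v + w = rho_1 + rho_2 + rho_3, and it is then 1/2 s_c(u, v)
   s_a(u + v - rho_c, w), with rho_a orthogonal to u and rho_c to w. This makes
   the associativity of the trace an identity of signs. *)
Require Import Defs.
From mathcomp Require Import all_boot all_order all_algebra.
From mathcomp Require Import ring lra zify.

Set Implicit Arguments.
Unset Strict Implicit.
Unset Printing Implicit Defensive.

Import Order.TTheory GRing.Theory Num.Theory.
Local Open Scope ring_scope.

(** * Rational numbers in a field of characteristic 0 *)

(** [ratr] is defined through the reduced fraction. In characteristic 0 a nonzero integer stays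
    nonzero in [F], so equality of fractions can be cross-multiplied and pulled back to the
    integers. *)
Lemma ratr_frac (F : fieldType) (charF : [pchar F] =i pred0) (a b : int) :
  b != 0 -> ratr (a%:~R / b%:~R) = a%:~R / b%:~R :> F.
Proof.
move=> b0.
have intF0 (z : int) : (z%:~R == 0 :> F) = (z == 0).
  have /pcharf0P natF0 := charF.
  by case: z => m; rewrite ?NegzE ?rmorphN ?oppr_eq0 /= natF0.
set q := (X in ratr X); rewrite /ratr.
apply/eqP; rewrite eqr_div ?intF0 ?denq_neq0 //.
rewrite -!intrM -subr_eq0 -rmorphB /= intF0 subr_eq0 -(eqr_int rat) !intrM.
rewrite -eqr_div ?intr_eq0 ?denq_neq0 //; apply/eqP.
by rewrite divq_num_den.
Qed.

Lemma ratrD_pchar0 (F : fieldType) (charF : [pchar F] =i pred0) (p q : rat) :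
  ratr (p + q) = ratr p + ratr q :> F.
Proof.
have /pcharf0P natF0 := charF.
have intF0 (z : int) : z != 0 -> z%:~R != 0 :> F.
  by case: z => m; rewrite ?NegzE ?rmorphN ?oppr_eq0 /= natF0.
rewrite -{1}(divq_num_den p) -{1}(divq_num_den q).
rewrite addf_div ?intr_eq0 ?denq_neq0 //.
rewrite -!intrM -intrD ratr_frac ?mulf_neq0 ?denq_neq0 //.
by rewrite /ratr addf_div ?intF0 ?denq_neq0 // -!intrM -intrD.
Qed.

Lemma ratrM_pchar0 (F : fieldType) (charF : [pchar F] =i pred0) (p q : rat) :
  ratr (p * q) = ratr p * ratr q :> F.
Proof.
rewrite -{1}(divq_num_den p) -{1}(divq_num_den q) mulf_div -!intrM.
by rewrite ratr_frac ?mulf_neq0 ?denq_neq0 // /ratr mulf_div -!intrM.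
Qed.

Lemma ratr_sum_pchar0 (F : fieldType) (charF : [pchar F] =i pred0)
    (I : finType) (f : I -> rat) :
  ratr (\sum_i f i) = \sum_i ratr (f i) :> F.
Proof.
apply: (big_morph _ (ratrD_pchar0 charF)); exact: (ratr_nat F 0).
Qed.

(** * Scalar product, and the two kinds of generalized roots *)

Section Euclid.
Context {n : nat}.
Implicit Types u v w : evec n.

Lemma dotC u v : dot u v = dot v u.
Proof. by apply: eq_bigr => i _; rewrite mulrC. Qed.

Lemma dotDl u v w : dot (u + v) w = dot u w + dot v w.
Proof. by rewrite -big_split; apply: eq_bigr => i _; rewrite mxE mulrDl. Qed.

Lemma dotZl (a : rat) u v : dot (a *: u) v = a * dot u v.
Proof. by rewrite mulr_sumr; apply: eq_bigr => i _; rewrite mxE mulrA. Qed.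

Lemma dotNl u v : dot (- u) v = - dot u v.
Proof. by rewrite -scaleN1r dotZl mulN1r. Qed.

Lemma dotDr u v w : dot w (u + v) = dot w u + dot w v.
Proof. by rewrite dotC dotDl !(dotC w). Qed.

Lemma dotZr (a : rat) u v : dot u (a *: v) = a * dot u v.
Proof. by rewrite dotC dotZl (dotC v). Qed.

Lemma dotNr u v : dot u (- v) = - dot u v.
Proof. by rewrite dotC dotNl dotC. Qed.

Lemma dot0l u : dot 0 u = 0.
Proof. by rewrite -(scale0r 0) dotZl mul0r. Qed.

Lemma dot_suml (I : Type) (r : seq I) (P : pred I) (f : I -> evec n) w :
  dot (\sum_(i <- r | P i) f i) w = \sum_(i <- r | P i) dot (f i) w.
Proof. by apply: (big_morph (fun u => dot u w)) => [u v|]; rewrite ?dotDl ?dot0l. Qed.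

Definition dotE := (dotDl, dotDr, dotNl, dotNr, dotZl, dotZr).

Lemma dot_kS u (i : 'I_(rk n)) : dot u (k n i.+1) = u 0 i.
Proof.
rewrite /dot (bigD1 i) //= !mxE eqxx mulr1 big1 ?addr0 // => j ne_ji.
by rewrite !mxE eqSS (negbTE (ne_ji : j != i :> nat)) mulr0.
Qed.

Lemma dot_kk (i j : nat) : (0 < i <= rk n)%N ->
  dot (k n i) (k n j) = (i == j)%:R.
Proof.
case: i => // i /andP[_ lt_i]; rewrite dotC (dot_kS (k n j) (Ordinal lt_i)).
by rewrite mxE.
Qed.

Lemma evecP u v :
  (forall i : 'I_(rk n), dot u (k n i.+1) = dot v (k n i.+1)) -> u = v.
Proof. by move=> e; apply/rowP=> i; rewrite -!dot_kS e. Qed.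

Lemma evec_sum_k u : u = \sum_(i < rk n) dot u (k n i.+1) *: k n i.+1.
Proof.
apply/rowP=> i; rewrite summxE (bigD1 i) //= !mxE eqxx mulr1 dot_kS.
rewrite big1 ?addr0 // => j ne_ji.
by rewrite !mxE eqSS eq_sym (negbTE (ne_ji : j != i :> nat)) mulr0.
Qed.

Lemma dot_spinor_k (A : {set 'I_(rk n)}) (i : 'I_(rk n)) :
  dot (spinor A) (k n i.+1) = if i \in A then 2^-1 else - 2^-1.
Proof.
rewrite /spinor dotZl dot_suml (bigD1 i) //= big1 => [|j ne_ji].
  by case: ifP => _; rewrite ?dotNl dot_kk ?ltn_ord ?eqxx //=; lra.
by case: ifP => _; rewrite ?dotNl dot_kk ?ltn_ord // eqSS
  (negbTE (ne_ji : j != i :> nat)) ?oppr0.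
Qed.

Lemma dot_spinor_spinor (A : {set 'I_(rk n)}) :
  dot (spinor A) (spinor A) = n.+1%:R.
Proof.
rewrite /dot (eq_bigr (fun=> 4^-1)) => [|i _].
  by rewrite sumr_const card_ord -[LHS]mulr_natr /rk natrM; field.
by rewrite -!dot_kS dot_spinor_k; case: ifP => _; lra.
Qed.

(** The boolean [true] stands for the minus sign, so that the sign is [(-1) ^+ s]. *)
Definition sk (s : bool) (j : nat) : evec n := if s then - k n j else k n j.

Lemma dot_sk s (i j : nat) : (0 < i <= rk n)%N ->
  dot (sk s i) (k n j) = (-1) ^+ s * (i == j)%:R.
Proof. by move=> ?; case: s; rewrite /sk ?dotNl dot_kk //= ?mulN1r ?mul1r. Qed.

Lemma PhiO_lt s t i j : (0 < i)%N -> (i < j)%N -> (j <= rk n)%N ->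
  sk s i + sk t j \in Phi n.
Proof.
move=> i0 ij jN; rewrite mem_cat; apply/orP; left; apply/flattenP.
exists [:: k n i + k n j; k n i - k n j; - k n i + k n j; - k n i - k n j].
  apply/allpairsPdep; exists i, j; split=> //; rewrite mem_index_iota //; lia.
by case: s; case: t; rewrite !inE eqxx ?orbT.
Qed.

Lemma PhiO_mem s t i j : i != j -> (0 < i <= rk n)%N -> (0 < j <= rk n)%N ->
  sk s i + sk t j \in Phi n.
Proof.
move=> ne_ij Hi Hj; case: (ltngtP i j) => [ij|ji|/eqP].
- by apply: PhiO_lt => //; lia.
- by rewrite addrC; apply: PhiO_lt => //; lia.
- by rewrite (negbTE ne_ij).
Qed.

Lemma PhiS_mem (A : {set 'I_(rk n)}) : ~~ odd #|A| -> spinor A \in Phi n.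
Proof. by move=> oA; rewrite mem_cat; apply/orP; right; apply: image_f. Qed.

Lemma PhiP u : u \in Phi n ->
  (exists s t i j, [/\ (0 < i)%N, (i < j)%N, (j <= rk n)%N & u = sk s i + sk t j])
  \/ exists2 A : {set 'I_(rk n)}, ~~ odd #|A| & u = spinor A.
Proof.
rewrite mem_cat => /orP[/flattenP[l /allpairsPdep[i [j]]]|/imageP[A oA ->]];
  last by right; exists A.
rewrite !mem_index_iota => -[Hi Hj ->].
have [i0 ij jN]: [/\ (0 < i)%N, (i < j)%N & (j <= rk n)%N] by split; lia.
rewrite !inE => /or4P[] /eqP ->; left.
- by exists false, false, i, j.
- by exists false, true, i, j.
- by exists true, false, i, j.
- by exists true, true, i, j.
Qed.

End Euclid.

(** * Sign changes in spinorial vectors *)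

Section Flip.
Context {n : nat}.
Implicit Types A : {set 'I_(rk n)}.

Definition flip A (a : 'I_(rk n)) := if a \in A then A :\ a else a |: A.

Lemma odd_flip A a : odd #|flip A a| = ~~ odd #|A|.
Proof.
rewrite /flip; case: ifP => aA; last by rewrite cardsU1 aA.
by rewrite [in RHS](cardsD1 a) aA /= negbK.
Qed.

Lemma in_flip A a b : (b \in flip A a) = (b \in A) (+) (b == a).
Proof.
by rewrite /flip; case: ifP => aA; rewrite !inE; case: eqVneq => [->|_];
  rewrite ?aA ?addbF ?addbT.
Qed.

(** Switching one sign adds or subtracts one basis vector. An even number of switches keeps the
    parity condition, which is how combinations of roots are recognized as spinorial roots. *)
Lemma spinor_flip A a : spinor (flip A a) = spinor A + sk (a \in A) a.+1.
Proof.
apply: evecP => i; rewrite dotDl !dot_spinor_k in_flip dot_sk ?ltn_ord //.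
rewrite eqSS (eq_sym (a : nat)) -(inj_eq val_inj).
by case: eqVneq => [/val_inj ->|_]; case: (_ \in A) => //=; lra.
Qed.

Lemma spinorC A : spinor (~: A) = - spinor A.
Proof.
apply: evecP => i; rewrite dotNl !dot_spinor_k inE.
by case: (i \in A); rewrite ?opprK.
Qed.

(** N is even, so a set of positions and its complement have cardinals of the same parity. Hence the
    negative of a spinorial root is again a root. *)
Lemma odd_setC A : odd #|~: A| = odd #|A|.
Proof.
have := congr1 odd (cardsC A); rewrite oddD card_ord /rk oddM /=.
by case: odd; case: odd.
Qed.

End Flip.

(** * The tip as the roots on two affine hyperplanes *)

Section Tip.
Context {n : nat}.
Context (n_ge1 : (1 <= n)%N).
Implicit Types u v w : evec n.

Lemma rk_ge8 : (8 <= rk n)%N.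
Proof. by rewrite /rk (leq_mul2l 4 2). Qed.

Lemma ord_of_index j : (0 < j <= rk n)%N -> {i : 'I_(rk n) | j = i.+1}.
Proof. by case: j => // j jN; exists (Ordinal (jN : (j < rk n)%N)). Qed.

Lemma Phi_opp u : u \in Phi n -> - u \in Phi n.
Proof.
case/PhiP=> [[s [t [i [j [i0 ij jN ->]]]]]|[A oA ->]].
  have -> : - (sk s i + sk t j) = sk (~~ s) i + sk (~~ t) j :> evec n.
    by rewrite opprD; case: s; case: t; rewrite /sk ?opprK.
  exact: PhiO_lt.
by rewrite -spinorC PhiS_mem // odd_setC.
Qed.

(* Spinorial roots have no integer coordinate. *)
Lemma Phi_norm u (z : int) j : u \in Phi n -> (0 < j <= rk n)%N ->
  dot u (k n j) = z%:~R -> dot u u = 2.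
Proof.
case/PhiP=> [[s [t [a [b [a0 ab bN ->]]]]] _ _|[A _ ->] /ord_of_index[i ->]].
  have [aN bN'] : (0 < a <= rk n)%N /\ (0 < b <= rk n)%N by lia.
  have ne_ab : (a == b) = false by lia.
  have ne_ba : (b == a) = false by lia.
  by case: s; case: t; rewrite /sk !dotE !dot_kk // !eqxx ne_ab ne_ba /=; lra.
rewrite dot_spinor_k => e.
have : (2 * z)%:~R = ((-1) ^+ (i \notin A))%:~R :> rat.
  by rewrite intrM -e; case: (i \in A); rewrite /= ?expr0 ?expr1 ?rmorphN /=; lra.
by move/intr_inj; case: (i \notin A); rewrite ?expr0 ?expr1; lia.
Qed.

Definition tip_shape u :=
  [\/ u = - k n 2 - k n 3,
      exists s i, (4 <= i <= rk n)%N /\ u = k n 1 + sk s i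
    | exists A : {set 'I_(rk n)}, [/\ ~~ odd #|A|,
        forall i : 'I_(rk n), (i < 3)%N -> (i \in A) = (i == 0%N :> nat)
        & u = spinor A]].

Lemma tipP u : u \in tip_Phi n -> tip_shape u.
Proof.
rewrite inE => /orP[/eqP ->|]; first by constructor 1.
rewrite !mem_cat => /or3P[/mapP[i]|/mapP[i]|/imageP[A]].
- by rewrite mem_index_iota => ? ->; constructor 2; exists false, i; split=> //; lia.
- by rewrite mem_index_iota => ? ->; constructor 2; exists true, i; split=> //; lia.
rewrite inE => /andP[oA /forallP A3] ->; constructor 3; exists A; split=> //.
by move=> i i3; have := A3 i; rewrite i3 => /eqP.
Qed.

Lemma tip_shape_mem u : tip_shape u -> u \in tip_Phi n.
Proof.
case=> [->|[s [i [iN ->]]]|[A [oA A3 ->]]]; first by rewrite mem_head.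
  rewrite inE !mem_cat; apply/orP; right; case: s; rewrite /sk.
    by rewrite (map_f (fun i => k n 1 - k n i)) ?orbT // mem_index_iota; lia.
  by rewrite (map_f (fun i => k n 1 + k n i)) // mem_index_iota; lia.
rewrite inE !mem_cat image_f ?orbT // inE oA.
by apply/forallP=> i; apply/implyP=> /A3 ->.
Qed.

Lemma tip_sub_Phi u : u \in tip_Phi n -> u \in Phi n.
Proof.
have N8 := rk_ge8.
case/tipP=> [->|[s [i [iN ->]]]|[A [oA A3 ->]]].
- by apply: (@PhiO_lt n true true 2 3); lia.
- by apply: (@PhiO_lt n false s 1 i); lia.
- exact: PhiS_mem.
Qed.

Lemma tip_level u : u \in tip_Phi n ->
  dot u (k n 2) = dot u (k n 1) - 1 /\ dot u (k n 3) = dot u (k n 1) - 1.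
Proof.
have N8 := rk_ge8.
case/tipP=> [->|[s [i [iN ->]]]|[A [oA A3 ->]]].
- by rewrite !dotE !dot_kk /=; lia || (split; lra).
- have [i1 [i2 i3]] : [/\ (i == 1) = false, (i == 2) = false & (i == 3) = false]%N.
    by split; lia.
  rewrite !dotDl !dot_sk; try lia.
  by rewrite !dot_kk ?i1 ?i2 ?i3 /=; lia || (split; lra).
have [i1 E1] := @ord_of_index 1 ltac:(lia).
have [i2 E2] := @ord_of_index 2 ltac:(lia).
have [i3 E3] := @ord_of_index 3 ltac:(lia).
rewrite E3 E2 E1 !dot_spinor_k !A3; try lia.
by case: E1 E2 E3 => <- [<-] [<-] /=; split; lra.
Qed.

(** Converse of [tip_level]. The two equations are affine, so they pass to u + v - rho_i and to
    rho_i + rho_j - u; for these vectors, being a root is enough to be in the tip. *)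
Lemma tip_of_level u : u \in Phi n ->
  dot u (k n 2) = dot u (k n 1) - 1 -> dot u (k n 3) = dot u (k n 1) - 1 ->
  u \in tip_Phi n.
Proof.
have N8 := rk_ge8.
case/PhiP=> [[s [t [a [b [a0 ab bN ->]]]]]|[A oA ->]]; last first.
  have [i1 E1] := @ord_of_index 1 ltac:(lia).
  have [i2 E2] := @ord_of_index 2 ltac:(lia).
  have [i3 E3] := @ord_of_index 3 ltac:(lia).
  move=> H2 H3; rewrite E2 E1 !dot_spinor_k in H2.
  rewrite E3 E1 !dot_spinor_k in H3.
  (* Of two coordinates equal to 1/2 or -1/2, the second is the first minus 1 only if they are 1/2
     and -1/2. *)
  have [A1 [A2 A3]] : [/\ i1 \in A, i2 \notin A & i3 \notin A].
    move: H2 H3; do 3![case: (_ \in A)] => H2 H3;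
      first [exfalso; clear -H2 H3; lra | by split].
  apply: tip_shape_mem; constructor 3; exists A; split=> // i.
  case: i => [[|[|[|//]]] lti] _ /=.
  - by rewrite (_ : Ordinal _ = i1) ?A1 //; apply: val_inj; case: E1.
  - by rewrite (_ : Ordinal _ = i2) ?(negbTE A2) //; apply: val_inj; case: E2.
  - by rewrite (_ : Ordinal _ = i3) ?(negbTE A3) //; apply: val_inj; case: E3.
rewrite !dotDl !dot_sk; try lia.
(* The smaller index is 1, 2 or at least 3. Only k_1 +/- k_b with b >= 4 and -k_2 - k_3 satisfy both
   equations. *)
case: a a0 ab => [//|[|[|a]]] _ ab.
- case: b ab bN => [|[|[|[|b]]]] // _ bN; rewrite ?eqxx /=.
  + by case: s; case: t => /=; lra.
  + by case: s; case: t => /=; lra.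
  case: s => /= [|_ _]; first by case: t => /=; lra.
  by apply: tip_shape_mem; constructor 2; exists t, b.+4; split=> //; lia.
- case: b ab bN => [|[|[|[|b]]]] // _ bN /=; last by case: s; case: t => /=; lra.
  case: s; case: t => /=; try lra.
  by move=> _ _; apply: tip_shape_mem; constructor 1.
have [b1 [b2 a1]] : [/\ (b == 1) = false, (b == 2) = false & (a.+3 == 1) = false]%N.
  by split; lia.
have a2 : (a.+3 == 2)%N = false by lia.
rewrite b1 b2 a1 a2.
by case: s; case: t => /=; lra.
Qed.

End Tip.

(** * The roots rho_i and the weights of tip roots along them *)

Definition rho n (i : 'I_3) : evec n := nth 0 (rhos n) i.

Section Rho.
Context {n : nat}.
Context (n_ge1 : (1 <= n)%N).
Implicit Types u v w : evec n.

Lemma rho_in_rhos i : rho n i \in rhos n.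
Proof. by rewrite mem_nth. Qed.

Lemma rhosP u : u \in rhos n -> exists i, u = rho n i.
Proof.
rewrite !inE => /or3P[] /eqP ->.
- by exists 0.
- by exists 1.
- by exists (Ordinal (isT : (2 < 3)%N)).
Qed.

Lemma dot_rho i u : dot (rho n i) u =
  match val i with
  | O => dot u (k n 1) + dot u (k n (rk n))
  | S O => dot u (k n 1) - dot u (k n (rk n))
  | _ => - dot u (k n 2) - dot u (k n 3)
  end.
Proof.
by case: i => [[|[|[|//]]] lti]; rewrite dotC /rho /= !dotE.
Qed.

Lemma rho_tip i : rho n i \in tip_Phi n.
Proof.
have N8 := rk_ge8 n_ge1; apply: (tip_shape_mem n_ge1).
case: i => [[|[|[|//]]] lti]; rewrite /rho /=.
- by constructor 2; exists false, (rk n); split=> //; lia.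
- by constructor 2; exists true, (rk n); split=> //; lia.
- by constructor 1.
Qed.

Lemma rho_Phi i : rho n i \in Phi n.
Proof. exact: (tip_sub_Phi n_ge1 (rho_tip i)). Qed.

(** By [dot_rho] only the coordinates 1, 2, 3 and N matter. On a spinorial root the last one decides
    which of the first two weights is 1, the other being 0, and the third weight is 1. *)
Lemma rho_weight i u : u \in tip_Phi n ->
  [\/ dot (rho n i) u = 0, dot (rho n i) u = 1
    | dot (rho n i) u = 2 /\ u = rho n i].
Proof.
have N8 := rk_ge8 n_ge1.
have N1 : (rk n == 1)%N = false by lia.
have [N2 [N3 [N1' _]]] : [/\ (2 == rk n) = false, (3 == rk n) = false,
  (1 == rk n) = false & True]%N by split=> //; lia.
move=> uT; have [L2 L3] := tip_level n_ge1 uT.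
rewrite dot_rho; case: (tipP uT) => [->|[s [a [aN ->]]]|[A [oA A3 eu]]].
- rewrite !dotE !dot_kk; try lia.
  rewrite N2 N3 /=; case: i => [[|[|[|//]]] lti] /=.
  + by constructor 1; lra.
  + by constructor 1; lra.
  by constructor 3; split; [lra | rewrite /rho].
- have [a1 [a2 a3]] : [/\ (a == 1) = false, (a == 2) = false & (a == 3) = false]%N.
    by split; lia.
  rewrite !dotDl !dot_sk; try lia.
  rewrite !dot_kk; try lia.
  rewrite a1 a2 a3 N1'; case: i => [[|[|[|//]]] lti] /=;
    case: (eqVneq a (rk n)) => [->|_].
  + case: s; first by constructor 1; rewrite /=; lra.
    by constructor 3; split; [rewrite /=; lra | rewrite /rho].
  + by constructor 2; rewrite /=; lra.
  + case: s; last by constructor 1; rewrite /=; lra.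
    by constructor 3; split; [rewrite /=; lra | rewrite /rho].
  + by constructor 2; rewrite /=; lra.
  + by constructor 1; rewrite /=; lra.
  + by constructor 1; rewrite /=; lra.
have [p1 E1] := @ord_of_index n 1 ltac:(lia).
have [pN EN] := @ord_of_index n (rk n) ltac:(lia).
have c1 : dot u (k n 1) = 2^-1.
  by rewrite eu E1 dot_spinor_k A3; case: E1 => <-.
have cN : dot u (k n (rk n)) = 2^-1 \/ dot u (k n (rk n)) = - 2^-1.
  have := dot_spinor_k A pN; rewrite -EN eu => ->.
  by case: (_ \in A); [left | right].
case: i => [[|[|[|//]]] lti] /=; rewrite ?L2 ?L3 c1.
- by case: cN => ->; [constructor 2; lra | constructor 1; lra].
- by case: cN => ->; [constructor 1; lra | constructor 2; lra].
by constructor 2; lra.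
Qed.

(** The sum of the rho_i is 2 k_1 - k_2 - k_3, and [tip_level] makes its product with a tip root
    constant. *)
Lemma sum_rho_weight u : u \in tip_Phi n ->
  dot (\sum_i rho n i) u = 2.
Proof.
move=> uT; have [L2 L3] := tip_level n_ge1 uT.
by rewrite dot_suml !big_ord_recl big_ord0 !dot_rho /= L2 L3; lra.
Qed.

Lemma dot_rho_rho i j : dot (rho n i) (rho n j) = if i == j then 2 else 0.
Proof.
have N8 := rk_ge8 n_ge1.
have [N2 [N3 [N1 [N2' [N3' N1']]]]] : [/\ (2 == rk n) = false, (3 == rk n) = false,
  (1 == rk n) = false & [/\ (rk n == 2) = false, (rk n == 3) = false &
  (rk n == 1) = false]]%N by split=> //; try split; lia.
rewrite dot_rho.
case: i => [[|[|[|//]]] ?]; case: j => [[|[|[|//]]] ?];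
  rewrite /rho /= !dotE !dot_kk; (try lia);
  by rewrite ?eqxx ?N1 ?N2 ?N3 ?N1' ?N2' ?N3' /=; lra.
Qed.

Lemma rho_inj : injective (@rho n).
Proof.
move=> i j e; apply/eqP; move: (dot_rho_rho i j); rewrite e dot_rho_rho eqxx.
by case: ifP => // _; lra.
Qed.

Lemma tip_add_sub_rho u v i : u \in tip_Phi n -> v \in tip_Phi n ->
  u + v - rho n i \in Phi n -> u + v - rho n i \in tip_Phi n.
Proof.
move=> uT vT wP.
have [u2 u3] := tip_level n_ge1 uT; have [v2 v3] := tip_level n_ge1 vT.
have [r2 r3] := tip_level n_ge1 (rho_tip i).
by apply: tip_of_level => //; rewrite !dotE; lra.
Qed.

(** On k_1 +/- k_a the subtraction cancels k_1 and leaves an orthogonal root with indices a and N.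
    On a spinorial root of weight 1 it switches two signs. *)
Lemma rho_sub_tip u i : u \in tip_Phi n -> dot (rho n i) u = 1 ->
  u - rho n i \in Phi n.
Proof.
have N8 := rk_ge8 n_ge1.
move=> uT; have [L2 L3] := tip_level n_ge1 uT.
rewrite dot_rho; case: (tipP uT) => [->|[s [a [aN ->]]]|[A [oA A3 eu]]].
- rewrite !dotE !dot_kk; try lia.
  have [N2 N3] : (2 == rk n)%N = false /\ (3 == rk n)%N = false by lia.
  rewrite N2 N3 /=; case: i => [[|[|[|//]]] lti] /=; lra.
- have [a1 [a2 a3]] : [/\ (a == 1) = false, (a == 2) = false & (a == 3) = false]%N.
    by split; lia.
  have N1 : (1 == rk n)%N = false by lia.
  rewrite !dotDl !dot_sk; try lia.
  rewrite !dot_kk; try lia.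
  rewrite a1 a2 a3 N1; case: i => [[|[|[|//]]] lti] /=; last by case: s => /=; lra.
    case: eqVneq => [_|aN' _]; first by case: s => /=; lra.
    rewrite /rho /= /rho1 opprD addrACA subrr add0r.
    by apply: (@PhiO_mem n s true a (rk n)); lia.
  case: eqVneq => [_|aN' _]; first by case: s => /=; lra.
  rewrite /rho /= /rho2 opprD opprK addrACA subrr add0r.
  by apply: (@PhiO_mem n s false a (rk n)); lia.
- have [p1 E1] := @ord_of_index n 1 ltac:(lia).
  have [p2 E2] := @ord_of_index n 2 ltac:(lia).
  have [p3 E3] := @ord_of_index n 3 ltac:(lia).
  have [pN EN] := @ord_of_index n (rk n) ltac:(lia).
  have A1 : p1 \in A by rewrite A3; case: E1 => <-.
  have A2 : p2 \in A = false by rewrite A3; case: E2 => <-.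
  have A3' : p3 \in A = false by rewrite A3; case: E3 => <-.
  have ne1N : (pN == p1) = false by rewrite -(inj_eq val_inj) /=; lia.
  have ne23 : (p3 == p2) = false by rewrite -(inj_eq val_inj) /=; lia.
  have c1 := dot_spinor_k A p1; rewrite A1 -E1 -eu in c1.
  have cN := dot_spinor_k A pN; rewrite -EN -eu in cN.
  case: i => [[|[|[|//]]] lti] /=; rewrite ?c1 ?cN /rho /= => w1.
  + have -> : u - rho1 n = spinor (flip (flip A p1) pN).
      rewrite !spinor_flip in_flip A1 ne1N addbF -E1 -EN eu.
      by case: (pN \in A) w1 => w1; [rewrite /sk /rho1 opprD addrA | exfalso; lra].
    by rewrite PhiS_mem // !odd_flip negbK.
  + have -> : u - rho2 n = spinor (flip (flip A p1) pN).
      rewrite !spinor_flip in_flip A1 ne1N addbF -E1 -EN eu.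
      by case: (pN \in A) w1 => w1; [exfalso; lra|];
        rewrite /sk /rho2 opprB addrA addrAC.
    by rewrite PhiS_mem // !odd_flip negbK.
  have -> : u - rho3 n = spinor (flip (flip A p2) p3).
    rewrite !spinor_flip in_flip A2 A3' ne23 -E2 -E3 eu.
    by rewrite /sk /rho3 opprD !opprK addrA.
  by rewrite PhiS_mem // !odd_flip negbK.
Qed.

(** On k_1 +/- k_a the only such pair is rho_1, rho_2, with sum 2 k_1, and the result is k_1 -/+
    k_a. On a spinorial root the pair contains rho_3. *)
Lemma rho_add_rho_sub_tip u i j : u \in tip_Phi n -> i != j ->
  dot (rho n i) u = 1 -> dot (rho n j) u = 1 ->
  rho n i + rho n j - u \in tip_Phi n.
Proof.
have N8 := rk_ge8 n_ge1.
wlog lt_ij : i j / (i < j)%N.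
  move=> H uT ne_ij wi wj; case: (ltngtP i j) => [ij|ji|/val_inj e].
  - exact: H.
  - by rewrite [rho n i + _]addrC; apply: H; rewrite // eq_sym.
  - by rewrite e eqxx in ne_ij.
move=> uT ne_ij wi wj.
suff wP : rho n i + rho n j - u \in Phi n.
  have [u2 u3] := tip_level n_ge1 uT.
  have [i2 i3] := tip_level n_ge1 (rho_tip i).
  have [j2 j3] := tip_level n_ge1 (rho_tip j).
  by apply: tip_of_level => //; rewrite !dotE; lra.
have [L2 L3] := tip_level n_ge1 uT.
move: wi wj; rewrite !dot_rho; case: (tipP uT) => [->|[s [a [aN eu]]]|[A [oA A3 eu]]].
- have [N2 N3] : (2 == rk n)%N = false /\ (3 == rk n)%N = false by lia.
  have [N1' _] : (2 == 1)%N = false /\ (3 == 1)%N = false by lia.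
  rewrite !dotE !dot_kk; try lia.
  by rewrite N2 N3 /=; case: i {ne_ij} lt_ij => [[|[|[|//]]] ?] _ /=; lra.
- have c1 : dot u (k n 1) = 1.
    have a1 : (a == 1)%N = false by lia.
    rewrite eu dotDl dot_sk; last lia.
    by rewrite dot_kk ?a1 ?eqxx /=; [lra | lia].
  case: i {ne_ij} lt_ij => [[|[|[|//]]] ?]; case: j => [[|[|[|//]]] ?] // _ /=;
    rewrite ?L2 ?L3 ?c1; try lra.
  move=> _ _; rewrite /rho /= /rho1 /rho2 eu.
  have -> : k n 1 + k n (rk n) + (k n 1 - k n (rk n)) - (k n 1 + sk s a)
    = sk false 1 + sk (~~ s) a.
    rewrite addrACA subrr addr0 opprD addrA addrK.
    by congr (_ + _); case: s {eu}; rewrite /sk ?opprK.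
  by apply: PhiO_mem; lia.
have [p1 E1] := @ord_of_index n 1 ltac:(lia).
have [p2 E2] := @ord_of_index n 2 ltac:(lia).
have [p3 E3] := @ord_of_index n 3 ltac:(lia).
have [pN EN] := @ord_of_index n (rk n) ltac:(lia).
have A1 : p1 \in A by rewrite A3; case: E1 => <-.
have A2 : p2 \in A = false by rewrite A3; case: E2 => <-.
have A3' : p3 \in A = false by rewrite A3; case: E3 => <-.
have [[neN1 neN2] neN3] :
  ((pN == p1) = false /\ (pN == p2) = false) /\ (pN == p3) = false.
  by rewrite -!(inj_eq val_inj) /=; lia.
have [[ne21 ne31] ne32] :
  ((p2 == p1) = false /\ (p3 == p1) = false) /\ (p3 == p2) = false.
  by rewrite -!(inj_eq val_inj) /=; lia.
have c1 := dot_spinor_k A p1; rewrite A1 -E1 -eu in c1.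
have cN := dot_spinor_k A pN; rewrite -EN -eu in cN.
(* The complement of [A] represents -u; adding rho_i + rho_3 switches its signs at the positions 1,
   2, 3 and N. *)
set B := flip (flip (flip (flip (~: A) p1) p2) p3) pN.
have BP : spinor B \in Phi n by rewrite PhiS_mem // !odd_flip !negbK odd_setC.
have eB : spinor B = - u + k n 1 - k n 2 - k n 3 + sk (pN \notin A) (rk n).
  rewrite !spinor_flip spinorC !in_flip !inE A1 A2 A3' neN1 neN2 neN3 ne21 ne31 ne32.
  by rewrite -E1 -E2 -E3 -EN !addbF /sk /= eu.
case: i {ne_ij} lt_ij => [[|[|[|//]]] ?]; case: j => [[|[|[|//]]] ?] // _ /=;
  rewrite ?L2 ?L3 ?c1 ?cN /rho /=.
- by case: (_ \in A); lra.
- case: (pN \in A) eB => eB w1 _; last by exfalso; lra.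
  suff -> : rho1 n + rho3 n - u = spinor B by [].
  rewrite eB /sk /= /rho1 /rho3.
  move: (k n 1) (k n 2) (k n 3) (k n (rk n)) => a b c d.
  by apply/rowP=> i; rewrite !mxE; lra.
case: (pN \in A) eB => eB w1 _; first by exfalso; lra.
suff -> : rho2 n + rho3 n - u = spinor B by [].
rewrite eB /sk /= /rho2 /rho3.
  move: (k n 1) (k n 2) (k n 3) (k n (rk n)) => a b c d.
  by apply/rowP=> i; rewrite !mxE; lra.
Qed.

End Rho.

(** * The root lattice and the bimultiplicativity of [eps] *)

Definition root_lattice n (u : evec n) :=
  exists c : 'I_(rk n) -> int, u = \sum_i (c i)%:~R *: alpha n i.+1.

Section Lattice.
Context {n : nat}.
Context (n_ge1 : (1 <= n)%N).
Implicit Types u v w : evec n.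

Local Notation L := (@root_lattice n).

Lemma latticeD u v : L u -> L v -> L (u + v).
Proof.
move=> [c ->] [d ->]; exists (fun i => c i + d i); rewrite -big_split.
by apply: eq_bigr => i _; rewrite intrD scalerDl.
Qed.

Lemma latticeN u : L u -> L (- u).
Proof.
move=> [c ->]; exists (fun i => - c i); rewrite -sumrN.
by apply: eq_bigr => i _; rewrite intrN scaleNr.
Qed.

Lemma latticeB u v : L u -> L v -> L (u - v).
Proof. by move=> Lu Lv; apply: latticeD => //; apply: latticeN. Qed.

Lemma lattice0 : L 0.
Proof. by exists (fun=> 0); rewrite big1 // => i _; rewrite scale0r. Qed.

Lemma lattice_sum (I : Type) (r : seq I) (P : pred I) (f : I -> evec n) :
  (forall i, P i -> L (f i)) -> L (\sum_(i <- r | P i) f i).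
Proof. exact: (big_ind _ lattice0 latticeD). Qed.

Lemma latticeMn u m : L u -> L (u *+ m).
Proof.
by move=> Lu; elim: m => [|m IH]; [apply: lattice0 | rewrite mulrS; apply: latticeD].
Qed.

Lemma lattice_alpha j : (0 < j <= rk n)%N -> L (alpha n j).
Proof.
move=> /ord_of_index[i ->]; exists (fun l => (l == i)%:R).
rewrite (bigD1 i) //= eqxx scale1r big1 ?addr0 // => l /negbTE ->.
by rewrite scale0r.
Qed.

Lemma alphaE j : (0 < j < (rk n).-1)%N -> alpha n j = k n j - k n j.+1.
Proof.
move=> jN; have [j1 j2] : (j == rk n) = false /\ (j == (rk n).-1) = false
  by clear n_ge1; lia.
by rewrite /alpha j1 j2.
Qed.

Lemma alpha_fork : alpha n (rk n).-1 = k n (rk n).-2 + k n (rk n).-1.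
Proof.
have N8 := rk_ge8 n_ge1; have e : ((rk n).-1 == rk n) = false by lia.
by rewrite /alpha e eqxx.
Qed.

Lemma alpha_last : alpha n (rk n) = spinor set0.
Proof.
rewrite /alpha eqxx /spinor -scalerN -sumrN big_add1 big_mkord.
by congr (_ *: _); apply: eq_bigr => i _; rewrite inE.
Qed.

Lemma sum_spinor (A : {set 'I_(rk n)}) :
  spinor A = alpha n (rk n) + \sum_(i in A) k n i.+1.
Proof.
rewrite alpha_last; apply: evecP => i; rewrite dotDl !dot_spinor_k inE dot_suml.
case: ifP => iA.
  rewrite (bigD1 i) //= dot_kk ?ltn_ord // eqxx big1; first by rewrite /=; lra.
  move=> j /andP[_ ne_ji]; rewrite dot_kk ?ltn_ord //.
  by rewrite eqSS (negbTE (ne_ji : j != i :> nat)).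
rewrite big1 ?addr0 // => j jA; rewrite dot_kk ?ltn_ord // eqSS.
by case: eqVneq => // /val_inj e; rewrite e iA in jA.
Qed.

(** Telescope the simple roots k_i - k_(i+1). They stop short of k_N, because alpha_(N-1) is k_(N-2)
    + k_(N-1). *)
Lemma lattice_k1_sub_lt j : (0 < j < rk n)%N -> L (k n 1 - k n j).
Proof.
elim: j => // -[|j] IH jN; first by rewrite subrr; apply: lattice0.
rewrite -[k n 1](subrK (k n j.+1)) -addrA; apply: latticeD; first by apply: IH; lia.
by rewrite -alphaE; [apply: lattice_alpha|]; lia.
Qed.

Lemma lattice_2k1 : L (k n 1 *+ 2).
Proof.
have N8 := rk_ge8 n_ge1.
have -> : k n 1 *+ 2 = alpha n (rk n).-1
    + ((k n 1 - k n (rk n).-2) + (k n 1 - k n (rk n).-1)).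
  by rewrite alpha_fork addrACA ![_ + (k n 1 - _)]addrC !subrK mulr2n.
apply: latticeD; first by apply: lattice_alpha; lia.
by apply: latticeD; apply: lattice_k1_sub_lt; lia.
Qed.

Lemma lattice_even_k1 m : ~~ odd m -> L (k n 1 *+ m).
Proof.
by move/even_halfK <-; rewrite -mul2n mulrnA; apply/latticeMn/lattice_2k1.
Qed.

(** Among the simple roots only alpha_N involves k_N. Doubling it clears the denominators, N k_1 is
    in the lattice because N is even, and the differences k_1 - k_i remove the other coordinates. *)
Lemma lattice_k1_sub_last : L (k n 1 - k n (rk n)).
Proof.
have N8 := rk_ge8 n_ge1.
have e : alpha n (rk n) *+ 2 = - \sum_(1 <= i < (rk n).+1) k n i.
  by rewrite /alpha eqxx mulNrn -scaler_nat scalerA mulfV ?scale1r.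
have -> : k n 1 - k n (rk n) = alpha n (rk n) *+ 2 + k n 1 *+ rk n
    - \sum_(1 <= i < rk n) (k n 1 - k n i).
  rewrite e big_nat_recr; last lia.
  have -> : k n 1 *+ rk n = k n 1 + \sum_(1 <= i < rk n) k n 1.
    by rewrite sumr_const_nat -mulrS; congr (_ *+ _); lia.
  rewrite sumrB; move: (\sum_(_ <= _ < _) k n 1) (\sum_(_ <= _ < _) _) => /= a b.
  by move: (k n 1) (k n (rk n)) => c d; apply/rowP=> i; rewrite !mxE; lra.
apply: latticeB; last first.
  rewrite big_nat_cond; apply: lattice_sum => i; rewrite andbT => iN.
  exact: lattice_k1_sub_lt.
apply: latticeD; first by apply: latticeMn; apply: lattice_alpha; lia.
by apply: lattice_even_k1; rewrite /rk oddM.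
Qed.

Lemma lattice_k1_sub j : (0 < j <= rk n)%N -> L (k n 1 - k n j).
Proof.
case: (eqVneq j (rk n)) => [-> _|ne jN]; first exact: lattice_k1_sub_last.
by apply: lattice_k1_sub_lt; lia.
Qed.

(** An orthogonal root is 2 k_1 minus two differences. A spinorial root is alpha_N plus the k_i over
    its plus signs, and their even number is what puts |A| k_1 into the lattice. *)
Lemma Phi_lattice u : u \in Phi n -> L u.
Proof.
have Lsk s j : (0 < j <= rk n)%N -> L (k n 1 - sk s j).
  move=> jN; case: s => /=; last exact: lattice_k1_sub.
  have -> : k n 1 - - k n j = k n 1 *+ 2 - (k n 1 - k n j).
    by rewrite opprB opprK mulr2n addrACA subrr addr0 addrC.
  by apply: latticeB; [apply: lattice_2k1 | apply: lattice_k1_sub].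
case/PhiP=> [[s [t [i [j [i0 ij jN ->]]]]]|[A oA ->]].
  have -> : sk s i + sk t j = k n 1 *+ 2 - ((k n 1 - sk s i) + (k n 1 - sk t j)).
    by rewrite mulr2n [(k n 1 - _) + _]addrACA -opprD subKr.
  apply: latticeB; first exact: lattice_2k1.
  by apply: latticeD; apply: Lsk; lia.
rewrite sum_spinor; apply: latticeD.
  by apply: lattice_alpha; rewrite leqnn andbT muln_gt0.
have -> : \sum_(i in A) k n i.+1 = k n 1 *+ #|A| - \sum_(i in A) (k n 1 - k n i.+1).
  by rewrite sumrB sumr_const subKr.
apply: latticeB; first exact: lattice_even_k1.
by apply: lattice_sum => i _; apply: lattice_k1_sub; rewrite ltn_ord.
Qed.

Lemma nth_simples (i : 'I_(rk n)) : (simples n)`_i = alpha n i.+1.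
Proof. by rewrite -tnth_nth tnth_mktuple. Qed.

Lemma lattice_span u : L u -> u \in <<simples n>>%VS.
Proof.
move=> [c ->]; apply: memv_suml => i _; apply: memvZ.
by rewrite -nth_simples memv_span // mem_nth // size_tuple.
Qed.

(** N spanning vectors in dimension N form a basis: k_1 is half of a lattice vector, and the other
    k_i differ from it by lattice vectors. *)
Lemma simples_basis : basis_of fullv (simples n).
Proof.
rewrite basisEdim size_tuple dimvf /dim /= mul1n leqnn andbT.
apply/subvP=> u _; rewrite (evec_sum_k u); apply: memv_suml => i _; apply: memvZ.
have k1_span : k n 1 \in <<simples n>>%VS.
  have -> : k n 1 = 2^-1 *: (k n 1 *+ 2) by rewrite -scaler_nat scalerA mulVf ?scale1r.
  exact/memvZ/lattice_span/lattice_2k1.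
rewrite -(subKr (k n 1) (k n i.+1)) rpredB //.
by apply: lattice_span; apply: lattice_k1_sub; rewrite ltn_ord.
Qed.

Lemma scoef_sum u : u = \sum_i scoef u i *: alpha n i.+1.
Proof.
rewrite {1}(coord_basis simples_basis (memvf u)).
by apply: eq_bigr => i _; rewrite nth_simples.
Qed.

Lemma scoefD u v i : scoef (u + v) i = scoef u i + scoef v i.
Proof. exact: linearD. Qed.

Lemma scoefN u i : scoef (- u) i = - scoef u i.
Proof. exact: linearN. Qed.

(** Freeness of the simple roots identifies [scoef] with the integers that define a lattice vector,
    so the numerators taken in [eps] lose nothing there. *)
Lemma numq_scoef u i : L u -> (numq (scoef u i))%:~R = scoef u i.
Proof.
move=> [c ->]; suff -> : scoef (\sum_j (c j)%:~R *: alpha n j.+1) i = (c i)%:~R.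
  by rewrite numq_int.
rewrite /scoef linear_sum (bigD1 i) //= linearZ /= -nth_simples.
rewrite coord_free ?(basis_free simples_basis) // eqxx mulr1 big1 ?addr0 // => j ne.
rewrite linearZ /= -nth_simples coord_free ?(basis_free simples_basis) //.
by rewrite (negbTE ne) mulr0.
Qed.

Lemma numq_scoefD u v i : L u -> L v ->
  numq (scoef (u + v) i) = numq (scoef u i) + numq (scoef v i).
Proof.
move=> Lu Lv; apply: (@intr_inj rat).
by rewrite intrD !numq_scoef ?scoefD //; apply: latticeD.
Qed.

Lemma eps0_unit (i j : 'I_(rk n)) : eps0 i j \is a @GRing.unit int.
Proof. by rewrite /eps0; case: ifP => _ //; case: ifP. Qed.

(** On the lattice [numq] is additive in the coefficients, and the values of [eps0] are units, so
    the exponents add up. *)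
Lemma epsDl u v w : L u -> L v -> eps (u + v) w = eps u w * eps v w.
Proof.
move=> Lu Lv; rewrite -big_split; apply: eq_bigr => i _ /=.
rewrite -big_split; apply: eq_bigr => j _ /=.
by rewrite numq_scoefD // mulrDl exprzDr ?eps0_unit.
Qed.

Lemma epsDr u v w : L u -> L v -> eps w (u + v) = eps w u * eps w v.
Proof.
move=> Lu Lv; rewrite -big_split; apply: eq_bigr => i _ /=.
rewrite -big_split; apply: eq_bigr => j _ /=.
by rewrite numq_scoefD // mulrDr exprzDr ?eps0_unit.
Qed.

Lemma eps_sqr u v : eps u v * eps u v = 1.
Proof.
rewrite -big_split big1 // => i _; rewrite -big_split big1 // => j _ /=.
rewrite -exprzMl ?eps0_unit //.
by rewrite /eps0; case: ifP => _; [|case: ifP => _]; rewrite ?mulrNN mulr1 exp1rz.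
Qed.

(* The inverse of the ring int is the identity function, whence the sign rules
   for eps in both arguments. *)
Lemma epsNl u v : eps (- u) v = eps u v.
Proof.
apply: eq_bigr => i _; apply: eq_bigr => j _.
by rewrite scoefN numqN mulNr -exprz_inv.
Qed.

Lemma epsNr u v : eps u (- v) = eps u v.
Proof.
apply: eq_bigr => i _; apply: eq_bigr => j _.
by rewrite scoefN numqN mulrN -exprz_inv.
Qed.

End Lattice.

(* The spinorial simple root has norm n + 1; changing the norm of k_N to 9 - N
   gives every simple root norm 2, so that eps becomes the usual asymmetry
   function of the even lattice obtained in this way. *)
Definition mform n (u v : evec n) : rat :=
  dot u v + (8 - (rk n)%:R) * (dot u (k n (rk n)) * dot v (k n (rk n))).

(** * The sign [eps u u] read off from the modified form *)

Section Asymmetry.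
Context {n : nat}.
Context (n_ge1 : (1 <= n)%N).
Implicit Types u v w : evec n.

Lemma mformC u v : mform u v = mform v u.
Proof. by rewrite /mform dotC [X in _ * X]mulrC. Qed.

Lemma mformD u v : mform (u + v) (u + v) = mform u u + mform v v + 2 * mform u v.
Proof. by rewrite /mform !dotE (dotC v u); ring. Qed.

(** With last coordinate 0 the correction vanishes and the root has norm 2. With last coordinate
    -1/2 the root is spinorial, and (n + 1) + (8 - 4(n + 1))/4 = 2. *)
Lemma mform_Phi u : u \in Phi n ->
  dot u (k n (rk n)) = 0 \/ dot u (k n (rk n)) = - 2^-1 -> mform u u = 2.
Proof.
have N8 := rk_ge8 n_ge1; move=> uP [e|e].
  by rewrite /mform e !mulr0 addr0; apply: (Phi_norm (z := 0) n_ge1 uP _ e); lia.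
case: (PhiP uP) => [[s [t [i [j [i0 ij jN eu]]]]]|[A oA eu]].
  have : (2 * ((-1) ^+ s * (i == rk n)%:R + (-1) ^+ t * (j == rk n)%:R) : int)%:~R
    = (-1 : int)%:~R :> rat.
    move: e; rewrite eu dotDl !dot_sk; try lia.
    by case: s {eu}; case: t; do 2![case: eqP => _]; rewrite /= => e; lra.
  move/intr_inj; lia.
by rewrite /mform eu dot_spinor_spinor -eu e /rk natrM; field.
Qed.

Lemma dot_alpha_last j : (0 < j <= rk n)%N ->
  dot (alpha n j) (k n (rk n)) = if j == rk n then - 2^-1 else 0.
Proof.
have N8 := rk_ge8 n_ge1; move=> jN.
have [pN EN] := @ord_of_index n (rk n) ltac:(lia).
case: eqVneq => [->|ne].
  by have := dot_spinor_k set0 pN; rewrite inE -EN alpha_last => ->.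
case: (eqVneq j (rk n).-1) => [->|ne'].
  rewrite alpha_fork // dotDl !dot_kk; try lia.
  have [-> ->] : ((rk n).-2 == rk n) = false /\ ((rk n).-1 == rk n) = false by lia.
  by rewrite addr0.
rewrite alphaE; last lia.
rewrite dotDl dotNl !dot_kk; try lia.
have [-> ->] : (j == rk n) = false /\ (j.+1 == rk n) = false by lia.
by rewrite subr0.
Qed.

Lemma mform_alpha_diag j : (0 < j <= rk n)%N -> mform (alpha n j) (alpha n j) = 2.
Proof.
have N8 := rk_ge8 n_ge1; move=> jN.
apply: mform_Phi; last by rewrite dot_alpha_last //; case: ifP; [right | left].
case: (eqVneq j (rk n)) => [->|ne]; first by rewrite alpha_last PhiS_mem // cards0.
case: (eqVneq j (rk n).-1) => [->|ne'].
  by rewrite alpha_fork //; apply: (@PhiO_mem n false false); lia.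
by rewrite alphaE; [apply: (@PhiO_mem n false true j j.+1)|]; lia.
Qed.

Lemma dot_k_spinor0 j : (0 < j <= rk n)%N ->
  dot (k n j) (spinor (set0 : {set 'I_(rk n)})) = - 2^-1.
Proof. by case/ord_of_index=> i ->; rewrite dotC dot_spinor_k inE. Qed.

(** For [mform] the simple roots form the simply laced diagram of type E_N: a chain 1, ..., N-2,
    with N-1 attached to N-3 and N attached to N-1. *)
Lemma mform_alpha_lt i j : (0 < i)%N -> (i < j)%N -> (j <= rk n)%N ->
  mform (alpha n i) (alpha n j) = 0 \/
  (mform (alpha n i) (alpha n j) = -1 /\ alpha n i + alpha n j \in Phi n).
Proof.
have N8 := rk_ge8 n_ge1; move=> i0 ij jN.
have di : dot (alpha n i) (k n (rk n)) = 0.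
  by rewrite dot_alpha_last; [rewrite ifF //|]; lia.
rewrite /mform di mul0r mulr0 addr0.
case: (eqVneq j (rk n)) => [ej|jN'].
  rewrite ej; case: (eqVneq i (rk n).-1) => [->|iN'].
    right; rewrite alpha_fork // alpha_last; split.
      by rewrite dotDl !dot_k_spinor0; try lia; lra.
    have [a Ea] := @ord_of_index n (rk n).-2 ltac:(lia).
    have [b Eb] := @ord_of_index n (rk n).-1 ltac:(lia).
    have -> : k n (rk n).-2 + k n (rk n).-1 + spinor set0
      = spinor (flip (flip set0 a) b).
      have ne_ba : (b == a) = false by rewrite -(inj_eq val_inj) /=; lia.
      by rewrite !spinor_flip in_flip !inE ne_ba -Ea -Eb /sk addrC addrA.
    by rewrite PhiS_mem // !odd_flip cards0.
  left; rewrite alphaE ?alpha_last; last lia.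
  by rewrite dotDl dotNl !dot_k_spinor0; try lia; lra.
rewrite [alpha n i]alphaE; last lia.
case: (eqVneq j (rk n).-1) => [->|jN''].
  rewrite alpha_fork // !dotE !dot_kk; try lia.
  have [f1 [f2 f3]] : [/\ (i == (rk n).-1) = false,
    (i.+1 == (rk n).-1) = (i == (rk n).-2) & (i == (rk n) - 3)%N = (i.+1 == (rk n).-2)].
    by split; lia.
  rewrite f1 f2; case: (eqVneq i.+1 (rk n).-2) => [e|ne].
    right; have f4 : (i == (rk n).-2) = false by lia.
    rewrite f4 -e; split; first by rewrite /=; lra.
    rewrite addrA subrK.
    by apply: (@PhiO_mem n false false i (rk n).-1); lia.
  by left; case: (eqVneq i (rk n).-2) => _ /=; lra.
rewrite alphaE; last lia.
rewrite !dotE !dot_kk; try lia.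
have [f1 [f2 f3]] : [/\ (i == j) = false, (i == j.+1) = false &
  (i.+1 == j.+1) = false] by split; lia.
rewrite f1 f2 f3; case: (eqVneq i.+1 j) => [e|_]; last by left; rewrite /=; lra.
right; split; first by rewrite /=; lra.
rewrite -e addrA subrK.
by apply: (@PhiO_mem n false true i i.+2); lia.
Qed.

(** The sum has last coordinate 0 or -1/2, hence norm 2 for [mform], like both terms; polarization
    gives -1. *)
Lemma mform_alpha_Phi i j : (0 < i)%N -> (i < j)%N -> (j <= rk n)%N ->
  alpha n i + alpha n j \in Phi n -> mform (alpha n i) (alpha n j) = -1.
Proof.
move=> i0 ij jN sP.
have := mformD (alpha n i) (alpha n j); rewrite !mform_alpha_diag; try lia.
rewrite mform_Phi //; first by lra.
rewrite dotDl !dot_alpha_last; try lia.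
by rewrite (_ : (i == rk n) = false); [case: ifP => _; [right | left]; lra | lia].
Qed.

Lemma prod_expz (I : finType) (x : int) (f : I -> int) : x \is a GRing.unit ->
  \prod_i x ^ f i = x ^ (\sum_i f i).
Proof. by move=> xu; apply/esym/big_morph => [a b|]; rewrite ?exprzDr ?expr0z. Qed.

Lemma mform_suml (I : finType) (a : I -> rat) (f : I -> evec n) v :
  mform (\sum_i a i *: f i) v = \sum_i a i * mform (f i) v.
Proof.
rewrite /mform !dot_suml mulr_suml mulr_sumr -big_split; apply: eq_bigr => i _ /=.
by rewrite !dotZl; ring.
Qed.

(** Write [eps0] as a power of -1 with exponent matrix [e], where e plus its transpose is the Gram
    matrix of [mform] on the simple roots. The exponent of [eps u u] is then half of [mform u u]. *)
Lemma eps_diag u (z : int) : root_lattice u -> mform u u = 2 * z%:~R ->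
  eps u u = (-1) ^ z.
Proof.
move=> Lu eq_z.
pose b (i j : 'I_(rk n)) :=
  (alpha n i.+1 + alpha n j.+1 \in Phi n) && (i < j)%N.
pose e (i j : 'I_(rk n)) : int := if i == j then 1 else - (b i j)%:R.
have e_lt (i j : 'I_(rk n)) : (i < j)%N ->
    (e i j + e j i)%:~R = mform (alpha n i.+1) (alpha n j.+1).
  move=> ij; have ne_ij : (i == j) = false by rewrite -(inj_eq val_inj) /=; lia.
  rewrite /e [j == i]eq_sym ne_ij /b ij (leq_gtF (ltnW ij)) andbF andbT oppr0 addr0.
  have := mform_alpha_lt (i := i.+1) (j := j.+1) isT ij (ltn_ord j).
  have := mform_alpha_Phi (i := i.+1) (j := j.+1) isT ij (ltn_ord j).
  case: (_ \in _) => [/(_ isT) -> _|_ [->|[_ //]]]; first by rewrite rmorphN.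
  by rewrite oppr0.
have e_sym i j : (e i j + e j i)%:~R = mform (alpha n i.+1) (alpha n j.+1).
  case: (ltngtP i j) => [|ji|/val_inj ->]; first exact: e_lt.
    by rewrite addrC mformC e_lt.
  by rewrite mform_alpha_diag ?ltn_ord // /e eqxx.
have eps0E i j : eps0 i j = (-1) ^ e i j.
  by rewrite /eps0 /e -/(b i j); case: ifP => // _; case: (b i j).
pose m i : int := numq (scoef u i).
have epsE : eps u u = (-1) ^ (\sum_i \sum_j e i j * (m i * m j)).
  rewrite -prod_expz //; apply: eq_bigr => i _; rewrite -prod_expz //.
  by apply: eq_bigr => j _; rewrite eps0E exprz_exp.
rewrite epsE; congr (_ ^ _).
set S := \sum_i _.
(* Doubling the exponent replaces [e] by its symmetrization. *)
suff : (S + S)%:~R = (z + z)%:~R :> rat by move/intr_inj; lia.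
have -> : S + S = \sum_i \sum_j (e i j + e j i) * (m i * m j).
  rewrite {2}/S exchange_big -big_split; apply: eq_bigr => i _ /=.
  by rewrite -big_split; apply: eq_bigr => j _ /=; rewrite mulrDl [m j * _]mulrC.
transitivity (mform u u); last by rewrite eq_z intrD; ring.
have expand w : mform u w = \sum_i scoef u i * mform (alpha n i.+1) w.
  by rewrite {1}(scoef_sum n_ge1 u) mform_suml.
rewrite expand rmorph_sum; apply: eq_bigr => i _ /=.
rewrite mformC expand mulr_sumr rmorph_sum; apply: eq_bigr => j _ /=.
by rewrite intrM e_sym intrM !(numq_scoef n_ge1 _ Lu) mformC; ring.
Qed.

(** By [eps_diag] it suffices that half of [mform u u] is odd. This half is 1, except for k_1 +/-
    k_N, where the correction 8 - N turns it into 3 - 2n. *)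
Lemma eps_tip u : u \in tip_Phi n -> eps u u = -1.
Proof.
have N8 := rk_ge8 n_ge1; move=> uT.
have uP := tip_sub_Phi n_ge1 uT; have Lu := Phi_lattice n_ge1 uP.
suff [z oz ez] : exists2 z : int, (-1 : int) ^ z = -1 & mform u u = 2 * z%:~R.
  by rewrite (eps_diag Lu ez).
have [pN EN] := @ord_of_index n (rk n) ltac:(lia).
case: (tipP uT) => [eu|[s [a [aN eu]]]|[A [oA A3 eu]]].
- exists 1 => //; rewrite mform_Phi // ?mulr1 //; left.
  rewrite eu dotDl !dotNl !dot_kk; try lia.
  have [-> ->] : (2 == rk n)%N = false /\ (3 == rk n)%N = false by lia.
  by rewrite /=; lra.
- have cN : dot u (k n (rk n)) = (-1) ^+ s * (a == rk n)%:R.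
    rewrite eu dotDl dot_sk ?dot_kk; try lia.
    by rewrite (_ : (1 == rk n)%N = false) ?add0r //; lia.
  have uu : dot u u = 2.
    apply: (Phi_norm (z := (-1) ^+ s * (a == rk n)%:R) (j := rk n) n_ge1 uP).
      by lia.
    by rewrite cN intrM rmorphXn rmorphN /=; case: (a == _).
  case: (eqVneq a (rk n)) => ea; rewrite ?ea ?eqxx ?(negbTE ea) in cN.
    exists (3 - 2 * n%:Z); last first.
      rewrite /mform uu cN; case: (s); rewrite /rk natrM -natr1 rmorphB rmorphM /=;
      by rewrite -pmulrn; ring.
    rewrite (_ : 3 - 2 * n%:Z = 1 + 2 * (1 - n%:Z)); last lia.
    by rewrite exprzDr // -exprz_exp exp1rz mulr1.
  exists 1 => //; rewrite mform_Phi // ?mulr1 //; left.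
  by rewrite cN mulr0.
exists 1 => //; rewrite /mform {1 2}eu dot_spinor_spinor.
have := dot_spinor_k A pN; rewrite -EN -eu => ->.
by rewrite /rk natrM; case: ifP => _; field.
Qed.
End Asymmetry.

(** * Weights of sums of tip roots, and the structure signs *)

Section Weights.
Context {n : nat}.
Context (n_ge1 : (1 <= n)%N).
Implicit Types u v w : evec n.

(** The second coordinate tells the two kinds of roots apart, and the kind determines the norm. *)
Lemma Phi_dot_k2 u : u \in Phi n -> exists z : int,
  (dot u (k n 2) = z%:~R /\ dot u u = 2) \/
  (dot u (k n 2) = z%:~R + 2^-1 /\ dot u u = n.+1%:R).
Proof.
have N8 := rk_ge8 n_ge1; move=> uP.
case: (PhiP uP) => [[s [t [a [b [a0 ab bN eu]]]]]|[A oA ->]].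
  have e : dot u (k n 2) = ((-1) ^+ s * (a == 2%N)%:R + (-1) ^+ t * (b == 2%N)%:R)%:~R.
    rewrite eu dotDl !dot_sk; try lia.
    by rewrite rmorphD !rmorphM !rmorph_sign !rmorph_nat.
  by eexists; left; split; [exact: e | apply: (Phi_norm n_ge1 uP _ e); lia].
have [p E2] := @ord_of_index n 2 ltac:(lia).
have := dot_spinor_k A p; rewrite -E2 dot_spinor_spinor => ->.
by case: (p \in A); [exists 0 | exists (-1)]; right; split=> //=; lra.
Qed.

Lemma tip_norm u : u \in tip_Phi n -> 2 <= dot u u.
Proof.
move=> uT; have [z] := Phi_dot_k2 (tip_sub_Phi n_ge1 uT).
case=> -[_ ->] //; rewrite ler_nat; lia.
Qed.

(* u and u - rho_i are roots of the same type, hence of the same norm. *)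
Lemma sub_rho_weight u i : u \in tip_Phi n ->
  (u - rho n i \in Phi n) = (dot (rho n i) u == 1).
Proof.
have N8 := rk_ge8 n_ge1; move=> uT; apply/idP/eqP; last exact: rho_sub_tip.
move=> dP; have [y yE] := Phi_dot_k2 (tip_sub_Phi n_ge1 uT).
have [z zE] := Phi_dot_k2 dP.
have [c cE] : exists c : int, dot (rho n i) (k n 2) = c%:~R.
  have N2 : (2 == rk n)%N = false by lia.
  rewrite dot_rho !dot_kk; try lia; rewrite N2.
  by exists (if val i is S (S _) then -1 else 0);
    case: i {dP zE} => [[|[|[|//]]] ?] /=; lra.
(* Equality of the norms of u and u - rho_i amounts to 2 - 2 (rho_i, u) = 0. *)
have nE : dot (u - rho n i) (u - rho n i) = dot u u - 2 * dot (rho n i) u + 2.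
  by rewrite !dotE dot_rho_rho // eqxx (dotC u); ring.
have dE : dot (u - rho n i) (k n 2) = dot u (k n 2) - c%:~R.
  by rewrite dotDl dotNl cE.
rewrite nE dE in zE.
have half (x : int) : x%:~R = 2^-1 :> rat -> False.
  move=> xE; have : (2 * x)%:~R = 1%:~R :> rat by rewrite intrM xE.
  by move/intr_inj; lia.
case: yE zE => -[-> ->] [] [e1 e2]; try lra; exfalso.
  by apply: (half (y - c - z)); rewrite !rmorphB /=; lra.
by apply: (half (z - y + c)); rewrite rmorphD rmorphB /=; lra.
Qed.

(* Such a root is orthogonal to exactly one rho_i and has weight 1 along the
   other two. *)
Definition nonrho u := u \in tip_Phi n /\ forall i, u <> rho n i.

Lemma nonrho_tip u : nonrho u -> u \in tip_Phi n.
Proof. by case. Qed.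

Lemma nonrho_or_rho u : u \in tip_Phi n -> (exists i, u = rho n i) \/ nonrho u.
Proof.
move=> uT; case: (boolP (u \in rhos n)) => [/rhosP|ur]; first by left.
by right; split=> // i e; rewrite e rho_in_rhos in ur.
Qed.

Lemma tip_weight_ge0 i u : u \in tip_Phi n -> 0 <= dot (rho n i) u.
Proof. by move=> uT; case: (rho_weight n_ge1 i uT) => [->|->|[-> _]]. Qed.

Lemma nonrho_weight i u : nonrho u -> dot (rho n i) u = 0 \/ dot (rho n i) u = 1.
Proof.
by case=> uT ur; case: (rho_weight n_ge1 i uT) => [?|?|[_ /ur//]]; [left|right].
Qed.

Lemma nonrho_weight_le1 i u : nonrho u -> dot (rho n i) u <= 1.
Proof. by case/(nonrho_weight i) => ->. Qed.

Lemma sum_rho i j l : i != j -> i != l -> j != l ->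
  \sum_m rho n m = rho n i + rho n j + rho n l.
Proof.
move=> ij il jl; rewrite (bigD1 i) //= (bigD1 j) 1?eq_sym //= (bigD1 l) /=; last first.
  by rewrite ![l == _]eq_sym il jl.
rewrite big1 ?addr0 ?addrA // => m /andP[/andP[mi mj] ml].
by case: i j l m ij il jl mi mj ml =>
  [[|[|[|//]]] ?] [[|[|[|//]]] ?] [[|[|[|//]]] ?] [[|[|[|//]]] ?].
Qed.

Lemma third_index (i o : 'I_3) : i != o ->
  exists j, forall l, (l == j) = (l != i) && (l != o).
Proof.
case: i o => [[|[|[|//]]] ?] [[|[|[|//]]] ?] // _;
  by [exists 0; case=> [[|[|[|//]]] ?] | exists 1; case=> [[|[|[|//]]] ?]
     | exists ord_max; case=> [[|[|[|//]]] ?]].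
Qed.

Lemma nonrho_omit u : nonrho u ->
  exists o, forall i, dot (rho n i) u = (i != o)%:R.
Proof.
move=> uN; have sum2 := sum_rho_weight n_ge1 (nonrho_tip uN).
have w i := nonrho_weight i uN.
case: (pickP (fun o => dot (rho n o) u == 0)) => [o /eqP wo|no0]; last first.
  move: sum2; rewrite dot_suml (eq_bigr (fun=> 1)) => [|i _].
    by rewrite sumr_const card_ord => /eqP; rewrite eqr_nat.
  by case: (w i) (no0 i) => // ->; rewrite eqxx.
exists o => i; case: eqVneq => [->|io] //=; case: (w i) => // wi.
have [j jP] := third_index io; have := jP j; rewrite eqxx => /esym/andP[ji jo].
move: sum2; rewrite (sum_rho (l := j) io) 1?eq_sym // !dotDl wo wi.
by have := nonrho_weight_le1 j uN; lra.
Qed.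

(** The weight of u + v - rho_i along rho_i is nonnegative, and it is the sum of two weights at most
    1, minus 2. *)
Lemma nonrho_sum_weight i u v : nonrho u -> nonrho v ->
  u + v - rho n i \in Phi n -> dot (rho n i) u = 1 /\ dot (rho n i) v = 1.
Proof.
move=> uN vN /(tip_add_sub_rho n_ge1 (nonrho_tip uN) (nonrho_tip vN)).
move/(tip_weight_ge0 i); rewrite !dotE dot_rho_rho // eqxx => ge0.
have := nonrho_weight_le1 i uN; have := nonrho_weight_le1 i vN.
by split; lra.
Qed.

(** Tells which terms of a product reach the trace. Along rho_o the sum u + v has weight at most 1,
    which excludes i = o and j = o; i = j would require weight 4 along rho_i, where u + v has at
    most 2. *)
Lemma nonrho_sum_eq o u v i j : nonrho u -> nonrho v -> dot (rho n o) u = 0 ->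
  (u + v - rho n j == rho n i) =
  [&& i != o, j != o, i != j & u + v == \sum_m rho n m - rho n o].
Proof.
move=> uN vN uo; rewrite subr_eq.
have tau_sub : i != o -> j != o -> i != j ->
    \sum_m rho n m - rho n o = rho n i + rho n j.
  by move=> io jo ij; rewrite (sum_rho ij io jo) addrK.
apply/eqP/and4P => [e|[io jo ij /eqP ->]]; last exact: tau_sub.
have wo := congr1 (dot (rho n o)) e; have wi := congr1 (dot (rho n i)) e.
rewrite !dotDr !dot_rho_rho // uo in wo; rewrite !dotDr !dot_rho_rho // eqxx in wi.
have vo := nonrho_weight_le1 o vN.
have ui := nonrho_weight_le1 i uN; have vi := nonrho_weight_le1 i vN.
have io : i != o by apply/eqP => eio; move: wo; rewrite eio eqxx; case: ifP => _; lra.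
have jo : j != o by apply/eqP => ejo; move: wo; rewrite ejo eqxx; case: ifP => _; lra.
have ij : i != j by apply/eqP => eij; move: wi; rewrite -eij eqxx; lra.
by split=> //; rewrite tau_sub // e.
Qed.

(* The coefficient of x_(u + v - rho_i) in 2 (x_u o x_v). *)
Definition tip_sign (i : 'I_3) u v : int :=
  - (eps u (rho n i) * eps u v * eps (rho n i) v).

Let tip_lattice u (uT : u \in tip_Phi n) : root_lattice u :=
  Phi_lattice n_ge1 (tip_sub_Phi n_ge1 uT).

Lemma eps_eq1 u v : eps u v = 1 \/ eps u v = -1.
Proof.
have : (eps u v - 1) * (eps u v + 1) = 0 by have := eps_sqr u v; lia.
by move/eqP; rewrite mulf_eq0 subr_eq0 addr_eq0 => /orP[] /eqP; [left|right].
Qed.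

Lemma tip_sign_rho i u : tip_sign i u (rho n i) = 1.
Proof. by rewrite /tip_sign eps_sqr (eps_tip n_ge1 (rho_tip n_ge1 i)). Qed.

(* Expand eps w w = -1 for the tip root w = u + v - rho_i. *)
Lemma tip_signC i u v : u \in tip_Phi n -> v \in tip_Phi n ->
  u + v - rho n i \in Phi n -> tip_sign i u v = tip_sign i v u.
Proof.
move=> uT vT wP; have := eps_tip n_ge1 (tip_add_sub_rho n_ge1 uT vT wP).
have Lu := tip_lattice uT; have Lv := tip_lattice vT.
have Lr := tip_lattice (rho_tip n_ge1 i).
have Lr' := latticeN Lr; have Luv := latticeD Lu Lv.
rewrite !(epsDl n_ge1, epsDr n_ge1, epsNl, epsNr) //.
rewrite !(eps_tip n_ge1) ?rho_tip // /tip_sign.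
by case: (eps_eq1 u v) => ->; case: (eps_eq1 v u) => ->;
  case: (eps_eq1 u (rho n i)) => ->; case: (eps_eq1 (rho n i) u) => ->;
  case: (eps_eq1 v (rho n i)) => ->; case: (eps_eq1 (rho n i) v) => ->.
Qed.

(** Expand [eps u (u + v)] and [eps (u + v) v] with u + v replaced by rho_i + rho_j, using that
    [eps u u] and [eps v v] are -1. *)
Lemma tip_sign_indep i j u v : u \in tip_Phi n -> v \in tip_Phi n ->
  u + v = rho n i + rho n j -> tip_sign i u v = tip_sign j u v.
Proof.
move=> uT vT e.
have Lu := tip_lattice uT; have Lv := tip_lattice vT.
have Li := tip_lattice (rho_tip n_ge1 i); have Lj := tip_lattice (rho_tip n_ge1 j).
have e1 : eps u (u + v) = eps u (rho n i + rho n j) by rewrite e.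
have e2 : eps (u + v) v = eps (rho n i + rho n j) v by rewrite e.
move: e1 e2; rewrite !(epsDl n_ge1, epsDr n_ge1) // !(eps_tip n_ge1) // /tip_sign.
by case: (eps_eq1 u v) => ->;
  case: (eps_eq1 u (rho n i)) => ->; case: (eps_eq1 (rho n i) v) => ->;
  case: (eps_eq1 u (rho n j)) => ->; case: (eps_eq1 (rho n j) v) => ->.
Qed.

(* Both sides expand to the same product of ten values of eps. *)
Lemma tip_sign_assoc a c u v w :
  u \in tip_Phi n -> v \in tip_Phi n -> w \in tip_Phi n ->
  tip_sign c u v * tip_sign a (u + v - rho n c) w =
  tip_sign a v w * tip_sign c u (v + w - rho n a).
Proof.
move=> uT vT wT; have Lu := tip_lattice uT; have Lv := tip_lattice vT.
have Lw := tip_lattice wT.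
have La := tip_lattice (rho_tip n_ge1 a); have Lc := tip_lattice (rho_tip n_ge1 c).
have La' := latticeN La; have Lc' := latticeN Lc.
have Luv := latticeD Lu Lv; have Lvw := latticeD Lv Lw.
by rewrite /tip_sign !(epsDl n_ge1, epsDr n_ge1, epsNl, epsNr) //; ring.
Qed.

End Weights.

(** * Bilinearity, brackets of basis elements, and coordinates *)

Section Bracket.
Context {F : fieldType} {n : nat}.
Implicit Types (u v w : evec n) (x y z : e8 F n).

Lemma bracketDl x y z : bracket (x + y) z = bracket x z + bracket y z.
Proof.
rewrite -big_split; apply: eq_bigr => a _ /=; rewrite -big_split.
by apply: eq_bigr => b _ /=; rewrite ffunE mulrDl scalerDl.
Qed.

Lemma bracketDr x y z : bracket z (x + y) = bracket z x + bracket z y.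
Proof.
rewrite -big_split; apply: eq_bigr => a _ /=; rewrite -big_split.
by apply: eq_bigr => b _ /=; rewrite ffunE mulrDr scalerDl.
Qed.

Lemma bracketZl (c : F) x y : bracket (c *: x) y = c *: bracket x y.
Proof.
rewrite scaler_sumr; apply: eq_bigr => a _ /=; rewrite scaler_sumr.
by apply: eq_bigr => b _ /=; rewrite ffunE scalerA mulrA.
Qed.

Lemma bracketZr (c : F) x y : bracket x (c *: y) = c *: bracket x y.
Proof.
rewrite scaler_sumr; apply: eq_bigr => a _ /=; rewrite scaler_sumr.
by apply: eq_bigr => b _ /=; rewrite ffunE scalerA mulrCA.
Qed.

Lemma bracket0l x : bracket 0 x = 0.
Proof. by rewrite -[X in bracket X _](scale0r 0) bracketZl scale0r. Qed.

Lemma bracket0r x : bracket x 0 = 0.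
Proof. by rewrite -[X in bracket _ X](scale0r 0) bracketZr scale0r. Qed.

Lemma bracketNl x y : bracket (- x) y = - bracket x y.
Proof. by rewrite -scaleN1r bracketZl scaleN1r. Qed.

Lemma bracketNr x y : bracket x (- y) = - bracket x y.
Proof. by rewrite -scaleN1r bracketZr scaleN1r. Qed.

Lemma bracket_suml (I : finType) (f : I -> e8 F n) x :
  bracket (\sum_i f i) x = \sum_i bracket (f i) x.
Proof.
apply: (big_morph (fun y => bracket y x)) => [y z|]; first exact: bracketDl.
exact: bracket0l.
Qed.

Lemma bracket_sumr (I : finType) (f : I -> e8 F n) x :
  bracket x (\sum_i f i) = \sum_i bracket x (f i).
Proof.
apply: (big_morph (bracket x)) => [y z|]; first exact: bracketDr.
exact: bracket0r.
Qed.

Lemma bracket_delta (a b : basis_index n) x y :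
  (forall c, x c = (c == a)%:R) -> (forall c, y c = (c == b)%:R) ->
  bracket x y = bracket_basis F a b.
Proof.
move=> xE yE; rewrite /bracket (bigD1 a) //= (bigD1 b) //= xE yE !eqxx mulr1 scale1r.
rewrite [X in _ + X + _]big1 => [|c /negbTE cb]; last by rewrite yE cb mulr0 scale0r.
rewrite [X in _ + X]big1 ?addr0 // => c /negbTE ca.
by rewrite big1 // => d _; rewrite xE ca mul0r scale0r.
Qed.

Lemma x_out u : u \notin Phi n -> x_ F u = 0.
Proof.
move=> uP; apply/ffunP=> -[i|r]; rewrite !ffunE //.
by case: eqP => // e; move: (valP r); rewrite e (negbTE uP).
Qed.

Lemma x_delta u (uP : u \in Phi n) (c : basis_index n) :
  x_ F u c = (c == inr (SeqSub uP))%:R.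
Proof. by rewrite ffunE; case: c. Qed.

Lemma h_delta i (c : basis_index n) : h F i c = (c == inl i)%:R.
Proof. by rewrite ffunE; case: c. Qed.

(** When u + v is not a root, the value 0 of [x_] outside the roots makes the formula hold as
    well. *)
Lemma bracket_x u v : u \in Phi n -> v \in Phi n -> v != - u ->
  bracket (x_ F u) (x_ F v) = (eps u v)%:~R *: x_ F (u + v).
Proof.
move=> uP vP /negbTE ne.
rewrite (bracket_delta (x_delta uP) (x_delta vP)) /= ne.
by case: ifP => // /negbT /x_out ->; rewrite scaler0.
Qed.

Lemma bracket_xN u : u \in Phi n -> bracket (x_ F u) (x_ F (- u)) = - h_ F u.
Proof.
move=> uP; have NuP := Phi_opp uP.
by rewrite (bracket_delta (x_delta uP) (x_delta NuP)) /= eqxx.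
Qed.

Lemma bracket_h (charF : [pchar F] =i pred0) (n_ge1 : (1 <= n)%N) u v :
  v \in Phi n -> bracket (h_ F u) (x_ F v) = ratr (dot u v) *: x_ F v.
Proof.
move=> vP; rewrite bracket_suml.
rewrite {2}(scoef_sum n_ge1 u) dot_suml (ratr_sum_pchar0 charF) scaler_suml.
apply: eq_bigr => i _; rewrite bracketZl (bracket_delta (h_delta i) (x_delta vP)) /=.
by rewrite scalerA dotZl (ratrM_pchar0 charF) dotC.
Qed.

Lemma IplusE : Iplus F n = \sum_i x_ F (rho n i).
Proof. by rewrite !big_ord_recl big_ord0 addr0 addrA. Qed.

Lemma IminusE : Iminus F n = - \sum_i x_ F (- rho n i).
Proof.
rewrite !big_ord_recl big_ord0 addr0 opprD /Iminus -addrA; congr (_ + _).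
exact/esym/opprD.
Qed.

Lemma circDl x y z : circ (x + y) z = circ x z + circ y z.
Proof. by rewrite /circ !bracketDl scalerDr. Qed.

Lemma circDr x y z : circ z (x + y) = circ z x + circ z y.
Proof. by rewrite /circ !bracketDr scalerDr. Qed.

Lemma circZl (c : F) x y : circ (c *: x) y = c *: circ x y.
Proof. by rewrite /circ !bracketZl !scalerA mulrC. Qed.

Lemma circZr (c : F) x y : circ x (c *: y) = c *: circ x y.
Proof. by rewrite /circ !bracketZr !scalerA mulrC. Qed.

Lemma circ_linearl (c : F) x y z : circ (c *: x + y) z = c *: circ x z + circ y z.
Proof. by rewrite circDl circZl. Qed.

Lemma circ_linearr (c : F) x y z : circ z (c *: x + y) = c *: circ z x + circ z y.
Proof. by rewrite circDr circZr. Qed.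

Lemma circ0l x : circ 0 x = 0.
Proof. by rewrite -[X in circ X _](scale0r 0) circZl scale0r. Qed.

Lemma circ0r x : circ x 0 = 0.
Proof. by rewrite -[X in circ _ X](scale0r 0) circZr scale0r. Qed.

Lemma circ_suml (I : finType) (f : I -> e8 F n) x :
  circ (\sum_i f i) x = \sum_i circ (f i) x.
Proof.
apply: (big_morph (fun y => circ y x)) => [y z|]; first exact: circDl.
exact: circ0l.
Qed.

Lemma xcoefD u x y : xcoef u (x + y) = xcoef u x + xcoef u y.
Proof. by rewrite /xcoef; case: insub => [r|]; rewrite ?ffunE ?addr0. Qed.

Lemma xcoefZ u (c : F) x : xcoef u (c *: x) = c * xcoef u x.
Proof. by rewrite /xcoef; case: insub => [r|]; rewrite ?ffunE ?mulr0. Qed.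

Lemma xcoef0 u : xcoef u (0 : e8 F n) = 0.
Proof. by rewrite -[X in xcoef _ X](scale0r 0) xcoefZ mul0r. Qed.

Lemma xcoef_x u v : u \in Phi n -> xcoef u (x_ F v) = (v == u)%:R.
Proof.
by move=> uP; rewrite /xcoef (insubT (fun u => u \in Phi n)) ffunE /= eq_sym.
Qed.

Lemma trE x : tr x = \sum_i xcoef (rho n i) x.
Proof. by rewrite !big_ord_recl big_ord0 addr0 addrA. Qed.

Lemma trD x y : tr (x + y) = tr x + tr y.
Proof. by rewrite !trE -big_split; apply: eq_bigr => i _; rewrite xcoefD. Qed.

Lemma trZ (c : F) x : tr (c *: x) = c * tr x.
Proof. by rewrite !trE mulr_sumr; apply: eq_bigr => i _; rewrite xcoefZ. Qed.

Lemma tr_linear (c : F) x y : tr (c *: x + y) = c * tr x + tr y.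
Proof. by rewrite trD trZ. Qed.

Lemma tr0 : tr (0 : e8 F n) = 0.
Proof. by rewrite -[X in tr X](scale0r 0) trZ mul0r. Qed.

Lemma tr_sum (I : finType) (f : I -> e8 F n) : tr (\sum_i f i) = \sum_i tr (f i).
Proof. by apply: (big_morph (@tr F n)) => [x y|]; [apply: trD | apply: tr0]. Qed.

Lemma xcoef_sum u (I : finType) (f : I -> e8 F n) :
  xcoef u (\sum_i f i) = \sum_i xcoef u (f i).
Proof.
by apply: (big_morph (@xcoef F n u)) => [x y|]; [apply: xcoefD | apply: xcoef0].
Qed.

Lemma x_tip u : u \in tip_Phi n -> x_ F u \in tip F n.
Proof. by move=> uT; apply/memv_span/map_f. Qed.

(** Reduces multilinear identities on the tip to the vectors [x_ F u]; the inductive step has the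
    shape of [circ_linearl] and [tr_linear]. *)
Lemma tip_ind (P : e8 F n -> Prop) : P 0 ->
  (forall (c : F) u x, u \in tip_Phi n -> P x -> P (c *: x_ F u + x)) ->
  forall x, x \in tip F n -> P x.
Proof.
move=> P0 PS x; rewrite /tip.
have : {subset tip_Phi n <= tip_Phi n} by [].
(* The spanning list is generalized to any list of tip roots. *)
elim: {1 3}(tip_Phi n) x => [|u s IH] x sT /=.
  by rewrite span_nil memv0 => /eqP ->.
rewrite span_cons => /memv_addP[_ /vlineP[c ->] [y ys ->]].
apply: PS; first by rewrite sT ?mem_head.
by apply: IH => // v vs; rewrite sT // inE vs orbT.
Qed.

End Bracket.

(** * The product on basis vectors of the tip *)

Section Product.
Context {F : fieldType} {n : nat}.
Context (charF : [pchar F] =i pred0) (n_ge1 : (1 <= n)%N).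
Implicit Types (u v w : evec n) (x y z : e8 F n).

Local Notation X u := (x_ F u).

Lemma two_neq0 : 2 != 0 :> F.
Proof. by have /pcharf0P -> := charF. Qed.

(** The inner bracket is an element -h if u = rho_i, and otherwise a multiple of x_(u - rho_i),
    which is nonzero only for weight 1 by [sub_rho_weight]. *)
Lemma double_bracket i u v : u \in tip_Phi n -> v \in tip_Phi n ->
  bracket (bracket (X u) (X (- rho n i))) (X v) =
  if u == rho n i then - (ratr (dot (rho n i) v) *: X v)
  else if dot (rho n i) u == 1 then - (tip_sign i u v)%:~R *: X (u + v - rho n i)
  else 0.
Proof.
move=> uT vT; have uP := tip_sub_Phi n_ge1 uT; have vP := tip_sub_Phi n_ge1 vT.
have rP := rho_Phi n_ge1 i.
case: eqP => [->|ne]; first by rewrite bracket_xN // bracketNl bracket_h.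
have ne' : - rho n i != - u by apply/eqP => /oppr_inj e; case: ne.
rewrite bracket_x ?Phi_opp // bracketZl -(sub_rho_weight n_ge1 i uT).
case: ifP => [dP|/negbT dP]; last by rewrite x_out // bracket0l scaler0.
(* Against the sum of the rho_m, v has product 2 and u - rho_i has product 0. *)
have ne'' : v != - (u - rho n i).
  apply/eqP => /(congr1 (dot (\sum_m rho n m))).
  rewrite dotNr dotDr dotNr !sum_rho_weight ?rho_tip //; lra.
rewrite bracket_x // scalerA addrAC epsNr -intrM /tip_sign rmorphN opprK.
have [Lu Lr] := (Phi_lattice n_ge1 uP, Phi_lattice n_ge1 rP).
by rewrite (epsDl n_ge1) ?epsNl ?mulrA //; apply: latticeN.
Qed.

Lemma circ_rho_x i v : v \in tip_Phi n ->
  circ (X (rho n i)) (X v) = (2^-1 * ratr (dot (rho n i) v)) *: X v.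
Proof.
move=> vT; have rT := @rho_tip n n_ge1.
rewrite /circ IminusE bracketNr bracket_sumr bracketNl bracket_suml.
rewrite (bigD1 i) //= double_bracket // eqxx big1 ?addr0 ?opprK ?scalerA // => j ji.
rewrite double_bracket // (inj_eq (rho_inj n_ge1)) eq_sym (negbTE ji).
by rewrite dot_rho_rho // (negbTE ji) eq_sym oner_eq0.
Qed.

Lemma circ_nonrho_x u v : nonrho u -> v \in tip_Phi n ->
  circ (X u) (X v) = 2^-1 *: \sum_i
    (if dot (rho n i) u == 1 then (tip_sign i u v)%:~R *: X (u + v - rho n i) else 0).
Proof.
move=> [uT ur] vT; rewrite /circ IminusE bracketNr bracket_sumr bracketNl bracket_suml.
rewrite -sumrN; congr (_ *: _); apply: eq_bigr => i _; rewrite double_bracket //.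
by case: eqP => [/ur//|_]; case: ifP => _; rewrite ?oppr0 // scaleNr opprK.
Qed.

Lemma circ_nonrho_rho i u : nonrho u ->
  circ (X u) (X (rho n i)) = (2^-1 * ratr (dot (rho n i) u)) *: X u.
Proof.
move=> uN; rewrite circ_nonrho_x ?rho_tip // (bigD1 i) //= big1 => [|j ji].
  rewrite addrK tip_sign_rho // scale1r addr0.
  case: (nonrho_weight n_ge1 i uN) => ->; last by rewrite eqxx (ratr_nat F 1) mulr1.
  by rewrite eq_sym oner_eq0 (ratr_nat F 0) mulr0 scale0r scaler0.
(* The vector u + rho_i - rho_j would have weight 1 + 0 - 2 < 0 along rho_j. *)
case: eqP => // w1; rewrite x_out ?scaler0 //; apply/negP.
move/(tip_add_sub_rho n_ge1 (nonrho_tip uN) (rho_tip n_ge1 i)).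
move/(tip_weight_ge0 n_ge1 j).
by rewrite !dotE w1 !dot_rho_rho // eqxx (negbTE ji); lra.
Qed.

Lemma circ_nonrho u v : nonrho u -> nonrho v ->
  circ (X u) (X v) = 2^-1 *: \sum_i (tip_sign i u v)%:~R *: X (u + v - rho n i).
Proof.
move=> uN vN; rewrite circ_nonrho_x ?nonrho_tip //; congr (_ *: _).
apply: eq_bigr => i _; case: eqP => // w; rewrite x_out ?scaler0 //.
by apply/negP => /(nonrho_sum_weight n_ge1 uN vN)[/w].
Qed.

Lemma circ_xC u v : u \in tip_Phi n -> v \in tip_Phi n ->
  circ (X u) (X v) = circ (X v) (X u).
Proof.
move=> uT vT.
case: (nonrho_or_rho uT) => [[i ->]|uN]; case: (nonrho_or_rho vT) => [[j ->]|vN].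
- rewrite !circ_rho_x ?rho_tip // !dot_rho_rho // eq_sym.
  by case: eqVneq => [->//|_]; rewrite (ratr_nat F 0) mulr0 !scale0r.
- by rewrite circ_rho_x // circ_nonrho_rho.
- by rewrite circ_rho_x // circ_nonrho_rho.
rewrite !circ_nonrho //; congr (_ *: _); apply: eq_bigr => i _.
rewrite [v + u]addrC; case: (boolP (u + v - rho n i \in Phi n)) => [wP|/x_out ->].
  by rewrite (tip_signC n_ge1 uT vT wP).
by rewrite !scaler0.
Qed.

Lemma circ_x_tip u v : u \in tip_Phi n -> v \in tip_Phi n ->
  circ (X u) (X v) \in tip F n.
Proof.
move=> uT vT; case: (nonrho_or_rho uT) => [[i ->]|uN].
  by rewrite circ_rho_x // memvZ // x_tip.
rewrite circ_nonrho_x // memvZ // memv_suml // => i _; case: ifP => _; last exact: mem0v.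
apply: memvZ; case: (boolP (u + v - rho n i \in Phi n)) => [wP|/x_out ->]; last exact: mem0v.
by apply/x_tip/tip_add_sub_rho.
Qed.

Lemma circ_tip x y : x \in tip F n -> y \in tip F n -> circ x y \in tip F n.
Proof.
move=> xT yT; move: x xT; apply: tip_ind => [|c u x uT IH]; first by rewrite circ0l mem0v.
rewrite circ_linearl memvD // memvZ // {x IH}.
move: y yT; apply: tip_ind => [|d v y vT IH]; first by rewrite circ0r mem0v.
by rewrite circ_linearr memvD // memvZ // circ_x_tip.
Qed.

End Product.

(** * The trace form, its associativity, and squares *)

Section Trace.
Context {F : fieldType} {n : nat}.
Context (charF : [pchar F] =i pred0) (n_ge1 : (1 <= n)%N).
Implicit Types (u v w : evec n) (x y z : e8 F n).

Local Notation X u := (x_ F u).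
Local Notation tau := (\sum_m rho n m).

Lemma ratr0 : ratr 0 = 0 :> F. Proof. exact: (ratr_nat F 0). Qed.
Lemma ratr1 : ratr 1 = 1 :> F. Proof. exact: (ratr_nat F 1). Qed.

Lemma addr_halves (a : F) : 2^-1 * a + 2^-1 * a = a.
Proof. by rewrite -mulrDl -mulr2n -[_ *+ 2]mulr_natr mulVf ?mul1r // two_neq0. Qed.

Lemma tr_x_rho i : tr (X (rho n i)) = 1.
Proof.
rewrite trE (bigD1 i) //= xcoef_x ?rho_Phi // eqxx big1 ?addr0 // => j ji.
by rewrite xcoef_x ?rho_Phi // (inj_eq (rho_inj n_ge1)) eq_sym (negbTE ji).
Qed.

Lemma xcoef_nonrho i u : nonrho u -> xcoef (rho n i) (X u) = 0.
Proof. by case=> uT ur; rewrite xcoef_x ?rho_Phi //; case: eqP => // /ur. Qed.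

Lemma tr_nonrho u : nonrho u -> tr (X u) = 0.
Proof. by move=> uN; rewrite trE big1 // => i _; apply: xcoef_nonrho. Qed.

(** Only the term l with u + v = rho_i + rho_l contributes, where i, l and o are distinct. By
    [tip_sign_indep] its sign may be computed with any j other than o, so it is the same for both
    possible i. *)
Lemma xcoef_circ_nonrho o j i u v : nonrho u -> nonrho v ->
  dot (rho n o) u = 0 -> j != o ->
  xcoef (rho n i) (circ (X u) (X v)) =
  if (u + v == tau - rho n o) && (i != o) then 2^-1 * (tip_sign j u v)%:~R else 0.
Proof.
move=> uN vN uo jo; rewrite circ_nonrho // xcoefZ xcoef_sum.
under eq_bigr => l _ do rewrite xcoefZ xcoef_x ?rho_Phi // (nonrho_sum_eq n_ge1 i l uN vN uo).
case: (eqVneq (u + v) _) => [uv|_]; last first.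
  by rewrite big1 ?mulr0 // => l _; rewrite !andbF mulr0.
case: (eqVneq i o) => [->|io] /=; first by rewrite big1 ?mulr0 // => l _; rewrite mulr0.
have [l lP] := third_index io; have := lP l; rewrite eqxx => /esym/andP[li lo].
rewrite (bigD1 l) //= lo eq_sym li mulr1 big1 ?addr0 => [|m ml]; last first.
  by move: ml; rewrite lP negb_and !negbK [i == m]eq_sym => /orP[] ->; rewrite ?andbF mulr0.
congr (_ * _%:~R); case: (eqVneq j l) => [->//|jl].
have ji : j = i by apply/eqP; move: jl; rewrite lP jo andbT negbK.
rewrite ji; apply: tip_sign_indep; rewrite ?nonrho_tip //.
by rewrite uv (sum_rho (i := l) (j := i) (l := o)) ?addrK.
Qed.

Lemma tr_circ_nonrho o j u v : nonrho u -> nonrho v ->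
  dot (rho n o) u = 0 -> j != o ->
  tr (circ (X u) (X v)) = if u + v == tau - rho n o then (tip_sign j u v)%:~R else 0.
Proof.
move=> uN vN uo jo; rewrite trE.
under eq_bigr => i _ do rewrite (xcoef_circ_nonrho i uN vN uo jo).
case: eqP => _ /=; last by rewrite big1.
by rewrite -big_mkcond sumr_const cardC1 card_ord mulr2n addr_halves.
Qed.

Lemma tr_circ_rho i x : x \in tip F n -> tr (circ (X (rho n i)) x) = xcoef (rho n i) x.
Proof.
move: x; apply: tip_ind => [|c u x uT IH].
  by rewrite circ0r tr0 xcoef0.
rewrite circ_linearr tr_linear xcoefD xcoefZ IH circ_rho_x // trZ; congr (_ * _ + _).
case: (nonrho_or_rho uT) => [[j ->]|uN]; last by rewrite tr_nonrho // xcoef_nonrho // mulr0.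
rewrite tr_x_rho mulr1 xcoef_x ?rho_Phi // (inj_eq (rho_inj n_ge1)) dot_rho_rho // eq_sym.
by case: eqP => _; rewrite ?ratr0 ?mulr0 // (ratr_nat F 2) mulVf // two_neq0.
Qed.

(** The trace of a product is shared among the rho_i in proportion to the weights of u. This settles
    associativity as soon as one factor is some x_(rho_i). *)
Lemma xcoef_circ i u v : u \in tip_Phi n -> v \in tip_Phi n ->
  xcoef (rho n i) (circ (X u) (X v)) =
  2^-1 * ratr (dot (rho n i) u) * tr (circ (X u) (X v)).
Proof.
have two0 := two_neq0 charF.
have rho_case j w : w \in tip_Phi n ->
    xcoef (rho n i) (circ (X (rho n j)) (X w)) =
    2^-1 * ratr (dot (rho n i) (rho n j)) * tr (circ (X (rho n j)) (X w)).
  move=> wT; rewrite circ_rho_x // xcoefZ trZ.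
  case: (nonrho_or_rho wT) => [[l ->]|wN]; last by rewrite tr_nonrho // xcoef_nonrho // !mulr0.
  rewrite tr_x_rho xcoef_x ?rho_Phi // (inj_eq (rho_inj n_ge1)) !dot_rho_rho //.
  case: (eqVneq j l) => [->|jl]; last by rewrite ratr0 !(mulr0, mul0r).
  rewrite [i == l]eq_sym (ratr_nat F 2) mulVf // !mul1r mulr1.
  by case: eqP => _; rewrite ?(ratr_nat F 2) ?ratr0 ?mulr0 ?mulVf.
move=> uT vT; case: (nonrho_or_rho uT) => [[j ->]|uN]; first exact: rho_case.
case: (nonrho_or_rho vT) => [[j ->]|vN].
  rewrite circ_nonrho_rho // xcoefZ trZ tr_nonrho // xcoef_nonrho //; by rewrite !mulr0.
have [o oP] := nonrho_omit n_ge1 uN.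
have uo : dot (rho n o) u = 0 by rewrite oP eqxx.
have [j jo] : exists j : 'I_3, j != o.
  by case: (o) => [[|[|[|//]]] ?]; [exists 1 | exists 0 | exists 0].
rewrite (xcoef_circ_nonrho i uN vN uo jo) (tr_circ_nonrho uN vN uo jo) oP.
case: eqP => _ /=; last by rewrite mulr0.
by case: (i != o); rewrite ?ratr1 ?ratr0 ?mulr1 ?mulr0 ?mul0r.
Qed.

Lemma tau_sub_tip o u : u \in tip_Phi n ->
  (forall i, dot (rho n i) u = (i != o)%:R) -> tau - rho n o - u \in tip_Phi n.
Proof.
move=> uT oP; have [i io] : exists i : 'I_3, i != o.
  by case: (o) => [[|[|[|//]]] ?]; [exists 1 | exists 0 | exists 0].
have [j jP] := third_index io; have := jP j; rewrite eqxx => /esym/andP[ji jo].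
have ij : i != j by rewrite eq_sym.
rewrite (sum_rho ij io jo) addrK.
by apply: rho_add_rho_sub_tip; rewrite ?oP ?io ?jo.
Qed.

Lemma dot_rho_tau i : dot (rho n i) tau = 2.
Proof. by rewrite dotC sum_rho_weight ?rho_tip. Qed.

(** A term u + v - rho_i pairs with w only if u + v + w is the sum of the rho_m. Along rho_i the
    weights of u and v are 1 and the total is 2, so w has weight 0 there and i = c. *)
Lemma tr_circ3_nonrho c j u v w : nonrho u -> nonrho v -> nonrho w ->
  (forall i, dot (rho n i) w = (i != c)%:R) -> j != c ->
  tr (circ (circ (X u) (X v)) (X w)) =
  if u + v + w == tau
  then 2^-1 * ((tip_sign c u v)%:~R * (tip_sign j (u + v - rho n c) w)%:~R) else 0.
Proof.
move=> uN vN wN cP jc; have wT := nonrho_tip wN.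
have eq_tau i : (u + v - rho n i + w == tau - rho n i) = (u + v + w == tau).
  by rewrite addrAC (inj_eq (addIr _)).
have term i : u + v - rho n i \in Phi n ->
    tr (circ (X (u + v - rho n i)) (X w)) =
    if (i == c) && (u + v + w == tau) then (tip_sign j (u + v - rho n c) w)%:~R else 0.
  move=> dP; have dT := tip_add_sub_rho n_ge1 (nonrho_tip uN) (nonrho_tip vN) dP.
  have [ui vi] := nonrho_sum_weight n_ge1 uN vN dP.
  have di : dot (rho n i) (u + v - rho n i) = 0.
    by rewrite !dotE ui vi dot_rho_rho // eqxx; lra.
  case: (nonrho_or_rho dT) => [[l dl]|dN].
    rewrite dl circ_rho_x // trZ tr_nonrho // mulr0.
    case: (eqVneq i c) => //= ic; case: eqP => // sum_tau; exfalso.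
    have il : i != l.
      by apply/eqP => eil; move: di; rewrite dl eil dot_rho_rho // eqxx; lra.
    (* If u + v - rho_i is some rho_l, then w would be the third rho_m. *)
    have [m mP] := third_index il; have := mP m; rewrite eqxx => /esym/andP[mi ml].
    case: (wN) => _ /(_ m); apply; have := eq_tau i; rewrite dl sum_tau eqxx.
    rewrite (sum_rho (i := l) (j := m) (l := i)) ?[l == _]eq_sym // addrK.
    by move/eqP/addrI.
  case: (eqVneq i c) => [ic|ic] /=.
    by rewrite (tr_circ_nonrho dN wN di (j := j)) ic ?eq_tau.
  rewrite (tr_circ_nonrho dN wN di (j := c)) 1?eq_sym // eq_sym eq_tau.
  case: eqP => // /(congr1 (dot (rho n i))) tau2; exfalso; move: tau2.
  by rewrite dot_rho_tau !dotDr ui vi cP ic /=; lra.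
rewrite circ_nonrho // circZl trZ circ_suml tr_sum (bigD1 c) //= big1 => [|i ic].
  rewrite addr0 circZl trZ.
  case: (boolP (u + v - rho n c \in Phi n)) => [/term ->|dP].
    by rewrite eqxx /=; case: ifP => _; rewrite ?mulr0.
  (* If the total is right, u + v - rho_c is the tip root of [tau_sub_tip] for w, so it cannot fail
     to be a root. *)
  rewrite x_out // circ0l tr0 !mulr0; case: eqP => // sum_tau; case/negP: dP.
  have -> : u + v - rho n c = tau - rho n c - w by rewrite -sum_tau [RHS]addrAC addrK.
  by apply/(tip_sub_Phi n_ge1)/tau_sub_tip.
rewrite circZl trZ; case: (boolP (u + v - rho n i \in Phi n)) => [/term ->|dP].
  by rewrite (negbTE ic) mulr0.
by rewrite x_out // circ0l tr0 mulr0.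
Qed.

Lemma circ_comm x y : x \in tip F n -> y \in tip F n -> circ x y = circ y x.
Proof.
move=> xT yT; move: x xT; apply: tip_ind => [|c u x uT IH].
  by rewrite circ0l circ0r.
rewrite circ_linearl circ_linearr IH; congr (_ *: _ + _) => {x IH}.
move: y yT; apply: tip_ind => [|d v y vT IH]; first by rewrite circ0l circ0r.
by rewrite circ_linearl circ_linearr IH circ_xC.
Qed.

Lemma tr_circ_x_assoc u v w :
  u \in tip_Phi n -> v \in tip_Phi n -> w \in tip_Phi n ->
  tr (circ (circ (X u) (X v)) (X w)) = tr (circ (X u) (circ (X v) (X w))).
Proof.
move=> uT vT wT.
have circT a b : a \in tip_Phi n -> b \in tip_Phi n -> circ (X a) (X b) \in tip F n.
  exact: circ_x_tip.
case: (nonrho_or_rho uT) => [[i ->]|uN].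
  by rewrite circ_rho_x // circZl trZ tr_circ_rho ?circT // xcoef_circ.
case: (nonrho_or_rho wT) => [[i ->]|wN].
  have rT := @rho_tip n n_ge1 i.
  rewrite [LHS](congr1 _ (circ_comm (circT _ _ uT vT) (x_tip rT))).
  rewrite tr_circ_rho ?circT // (circ_xC _ _ uT vT) // xcoef_circ //.
  by rewrite (circ_xC _ _ vT rT) // circ_rho_x // circZr trZ (circ_xC _ _ uT vT).
case: (nonrho_or_rho vT) => [[i ->]|vN].
  have rT := @rho_tip n n_ge1 i.
  rewrite (circ_xC _ _ uT rT) // !circ_rho_x // circZl circZr [LHS]trZ [RHS]trZ.
  by rewrite -xcoef_circ // (circ_xC _ _ uT wT) // xcoef_circ.
have [a aP] := nonrho_omit n_ge1 uN; have [c cP] := nonrho_omit n_ge1 wN.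
(* Commutativity turns the right side into a product of v, w, u bracketed to the left, so that
   [tr_circ3_nonrho] evaluates both sides. *)
rewrite [RHS](congr1 _ (circ_comm (x_tip uT) (circT _ _ vT wT))).
have pick (o : 'I_3) : exists i : 'I_3, i != o.
  by case: o => [[|[|[|//]]] ?]; [exists 1 | exists 0 | exists 0].
have rot : v + w + u = u + v + w by rewrite addrC addrA.
case: (eqVneq (u + v + w) tau) => [sum_tau|ne]; last first.
  have [j jc] := pick c; have [l la] := pick a.
  rewrite (tr_circ3_nonrho uN vN wN cP jc) (tr_circ3_nonrho vN wN uN aP la).
  by rewrite rot (negbTE ne).
(* If u and w were orthogonal to the same rho_a, then v would have weight 2 along it. *)
have ac : a != c.
  apply/eqP => ac; have := dot_rho_tau a.
  rewrite -sum_tau !dotDr aP cP ac eqxx /= add0r addr0 => v2.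
  by have := nonrho_weight_le1 n_ge1 c vN; rewrite v2; lra.
have ca : c != a by rewrite eq_sym.
rewrite (tr_circ3_nonrho uN vN wN cP ac) (tr_circ3_nonrho vN wN uN aP ca).
rewrite rot sum_tau eqxx -!intrM; congr (_ * _%:~R).
have e : v + w - rho n a = tau - rho n a - u by rewrite -sum_tau -rot [RHS]addrAC addrK.
have [b bP] := third_index ac; have := bP b; rewrite eqxx => /esym/andP[ba bc].
(* Exchanging the arguments needs a root: v + w - rho_a + u - rho_c is the remaining rho_b. *)
rewrite tip_sign_assoc // [tip_sign c _ u]tip_signC //; first by rewrite e tau_sub_tip.
by rewrite e subrK (sum_rho bc ba ca) addrK addrK rho_Phi.
Qed.

Lemma tr_circ_assoc x y z : x \in tip F n -> y \in tip F n -> z \in tip F n ->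
  tr (circ (circ x y) z) = tr (circ x (circ y z)).
Proof.
move=> xT yT zT; move: x xT; apply: tip_ind => [|c u x uT IH].
  by rewrite !circ0l.
rewrite !circ_linearl !tr_linear IH; congr (_ * _ + _) => {x IH}.
move: y yT; apply: tip_ind => [|d v y vT IH]; first by rewrite circ0r !circ0l circ0r.
rewrite !(circ_linearl, circ_linearr) !tr_linear IH; congr (_ * _ + _) => {y IH}.
move: z zT; apply: tip_ind => [|e w z wT IH]; first by rewrite !circ0r.
by rewrite !circ_linearr !tr_linear IH tr_circ_x_assoc.
Qed.

Lemma circ_Iplus x : x \in tip F n -> circ (Iplus F n) x = x.
Proof.
move: x; apply: tip_ind => [|c u x uT IH]; first by rewrite circ0r.
rewrite circ_linearr IH IplusE circ_suml; congr (_ *: _ + _).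
under eq_bigr => i _ do rewrite circ_rho_x //.
rewrite -scaler_suml -mulr_sumr -(ratr_sum_pchar0 charF) -dot_suml.
by rewrite sum_rho_weight // (ratr_nat F 2) mulVf ?scale1r // two_neq0.
Qed.

Lemma Iplus_tip : Iplus F n \in tip F n.
Proof. by rewrite IplusE memv_suml // => i _; rewrite x_tip ?rho_tip. Qed.

Lemma circ_rho_idem i : circ (X (rho n i)) (X (rho n i)) = X (rho n i).
Proof.
rewrite circ_rho_x ?rho_tip // dot_rho_rho // eqxx (ratr_nat F 2).
by rewrite mulVf ?scale1r // two_neq0.
Qed.

(* If 2u - rho_i were a root its weights would make it another rho_j, so that
   u would be the midpoint of rho_i and rho_j, which has norm 1. *)
Lemma circ_nonrho_sqr u : nonrho u -> circ (X u) (X u) = 0.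
Proof.
move=> uN; have uT := nonrho_tip uN; rewrite circ_nonrho // big1 ?scaler0 // => i _.
rewrite x_out ?scaler0 //; apply/negP => dP.
have [ui _] := nonrho_sum_weight n_ge1 uN uN dP.
have dT := tip_add_sub_rho n_ge1 uT uT dP.
have [o oP] := nonrho_omit n_ge1 uN.
have io : i != o by apply/eqP => io; move: ui; rewrite oP io eqxx /=; lra.
have [j jP] := third_index io; have := jP j; rewrite eqxx => /esym/andP[ji jo].
have dj : dot (rho n j) (u + u - rho n i) = 2.
  by rewrite !dotE dot_rho_rho // (negbTE ji) oP jo /=; lra.
have ej : u + u - rho n i = rho n j.
  by case: (rho_weight n_ge1 j dT) => [e|e|[_ //]]; rewrite dj in e; exfalso; lra.
have uu : u + u = rho n i + rho n j by rewrite -ej [RHS]addrC subrK.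
have := congr1 (fun v => dot v v) uu.
rewrite !dotE !dot_rho_rho // !eqxx (negbTE ji) [i == j]eq_sym (negbTE ji).
by have := tip_norm n_ge1 uT; lra.
Qed.

End Trace.

Theorem proposition4p8 (F : fieldType) (charF : [pchar F] =i pred0)
    (n : nat) (n_ge1 : (1 <= n)%N) :
  [/\ (* circ is a product on the tip, and it is commutative *)
      (forall x y : e8 F n, x \in tip F n -> y \in tip F n ->
         circ x y \in tip F n)
      /\ (forall x y : e8 F n, x \in tip F n -> y \in tip F n ->
            circ x y = circ y x),
      Iplus F n \in tip F n
      /\ (forall x : e8 F n, x \in tip F n ->
            circ (Iplus F n) x = x /\ circ x (Iplus F n) = x),
      forall u : evec n, u \in rhos n ->
        [/\ x_ F u \in tip F n, tr (x_ F u) = 1,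
            idempotent_circ (x_ F u) & rank1 (x_ F u)],
      forall u : evec n, u \in tip_Phi n -> u \notin rhos n ->
        [/\ x_ F u \in tip F n, nilpotent_circ (x_ F u),
            tr (x_ F u) = 0 & rank1 (x_ F u)]
    & [/\ forall (a : F) (x y z : e8 F n),
            x \in tip F n -> y \in tip F n -> z \in tip F n ->
            trform (a *: x + y) z = a * trform x z + trform y z,
          forall (a : F) (x y z : e8 F n),
            x \in tip F n -> y \in tip F n -> z \in tip F n ->
            trform z (a *: x + y) = a * trform z x + trform z y,
          forall x y : e8 F n, x \in tip F n -> y \in tip F n ->
            trform x y = trform y x
        & forall x y z : e8 F n,
            x \in tip F n -> y \in tip F n -> z \in tip F n ->
            trform (circ x y) z = trform x (circ y z)]].
Proof.
have commT := @circ_comm F n charF n_ge1.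
split.
- by split; [apply: circ_tip | apply: commT].
- split=> [|x xT]; first exact: Iplus_tip.
  by rewrite (commT x) ?Iplus_tip // circ_Iplus.
- move=> _ /rhosP[i ->].
  have idem := @circ_rho_idem F n charF n_ge1 i.
  have tr1 := @tr_x_rho F n n_ge1 i.
  split=> //; first exact/x_tip/rho_tip.
  by rewrite /rank1 /sharp idem tr1 scale1r expr1n !subrr mulr0 scale0r subrr.
- move=> u uT ur.
  have uN : nonrho u by split=> // i e; rewrite e rho_in_rhos in ur.
  have sqr0 := @circ_nonrho_sqr F n charF n_ge1 u uN.
  have tr_u := @tr_nonrho F n n_ge1 u uN.
  split=> //; first exact: x_tip.
    (* The exponent 1 of [circ_pow] denotes the square. *)
    by exists 1%N.
  by rewrite /rank1 /sharp sqr0 tr_u tr0 expr0n subrr mulr0 !scale0r !subrr.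
split=> [a x y z _ _ _|a x y z _ _ _|x y xT yT|x y z xT yT zT].
- by rewrite /trform circ_linearl tr_linear.
- by rewrite /trform circ_linearr tr_linear.
- by rewrite /trform commT.
- exact: tr_circ_assoc.
Qed.
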